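(* Let $A$ be a semibounded self-adjoint operator with domain $\mathfrak D(A)$ in a separable Hilbert space $\mathcal H$, and let $\omega_1,\omega_2\in\mathcal H_{-2}$ be two vectors such that $\langle\omega_2,(A-z)^{-1}\omega_1\rangle$ does not exist. Let $\alpha\in\mathbb C\setminus\{0\}$, $\tau\in\mathbb C$, and let $\tilde A=A+\alpha\langle\cdot,\omega_1\rangle\omega_2\in\mathcal P_\tau(A)$. Then there exist two sequences $\omega_{1,n},\omega_{2,n}\in\mathcal H_{-2}$ converging in $\mathcal H_{-2}$ to $\omega_1,\omega_2$ respectively, with $$\lim_{n\to\infty}\langle\omega_{2,n},A(A^2+1)^{-1}\omega_{1,n}\rangle=\tau,$$ such that the operators $\tilde A_n=A+\alpha\langle\cdot,\omega_{1,n}\rangle\omega_{2,n}\in\mathcal P(A)$ converge to $\tilde A$ in the norm resolvent sense.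
   Context: $\mathcal H$ is a separable complex Hilbert space with inner product $(\cdot,\cdot)$, linear in the first argument; $A$ is self-adjoint with domain $\mathfrak D(A)$, bounded from below, with spectral measure $E$. $\rho(\cdot)$ is the resolvent set. Scale of spaces: for $k=1,2$, $\mathcal H_{+k}=\mathfrak D(|A|^{k/2})$ with norm $\|(|A|+I)^{k/2}\varphi\|$ (so $\mathcal H_{+2}=\mathfrak D(A)$), and $\mathcal H_{-k}$ is the completion of $\mathcal H$ in the norm $\|f\|_{-k}=\|(|A|+I)^{-k/2}f\|$. $\langle\cdot,\cdot\rangle$ is the duality pairing between $\mathcal H_{+k}$ and $\mathcal H_{-k}$ (in either order) extending $(\cdot,\cdot)$. $A$ extends to a bounded operator $\mathcal H\to\mathcal H_{-2}$, and $R_z=(A-z)^{-1}$, $z\in\rho(A)$, extends to a bounded operator $\mathcal H_{-2}\to\mathcal H$; the same symbols are used for the extensions (likewise for other functions of $A$). Perturbed operators: let $\omega_1,\omega_2\in\mathcal H_{-2}\setminus\mathcal H$, $\omega_1\ne\omega_2$, $\alpha\in\mathbb C\setminus\{0\}$. Let $\nu$ be the complex measure $\nu(\Delta)=(E(\Delta)(A^2+1)^{-1/2}\omega_2,(A^2+1)^{-1/2}\omega_1)$ on $\mathbb R$. The form $\langle\omega_2,A(A^2+1)^{-1}\omega_1\rangle$ is said to exist if $\int|t|\,d|\nu|(t)<\infty$; its value is then $\int t\,d\nu(t)$; equivalently, $\langle\omega_2,(A-\bar z)^{-1}\omega_1\rangle=\int\frac{t^2+1}{t-z}\,d\nu(t)$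 exists (converges absolutely) for $z\in\rho(A)$. (If the form does not exist, then automatically $\omega_1,\omega_2\notin\mathcal H$.) If it exists, $\tau$ denotes this value and one writes $\tilde A\in\mathcal P(A)$; if it does not exist, $\tau\in\mathbb C$ is an arbitrary parameter and one writes $\tilde A\in\mathcal P_\tau(A)$. The operator $\tilde A=A+\alpha\langle\cdot,\omega_1\rangle\omega_2$ is defined in both cases by $$\mathfrak D(\tilde A)=\{\psi=\varphi+b\,A(A^2+1)^{-1}\omega_2:\ \varphi\in\mathfrak D(A),\ b\in\mathbb C,\ b=-\alpha(\langle\varphi,\omega_1\rangle+b\tau)\},\qquad \tilde A\psi=A\varphi-b(A^2+1)^{-1}\omega_2 .$$ Norm resolvent convergence $\tilde A_n\to\tilde A$: for every $z\in\rho(A)\cap\rho(\tilde A)$ one has $z\in\rho(\tilde A_n)$ for all large $n$ and $\|(\tilde A_n-z)^{-1}-(\tilde A-z)^{-1}\|\to0$. *)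

(* Defs.v *)
From HB Require Import structures.
From mathcomp Require Import all_boot all_order all_algebra.
From mathcomp Require Import complex.
From mathcomp Require Import all_classical all_reals all_analysis.

Set Implicit Arguments.
Unset Strict Implicit.
Unset Printing Implicit Defensive.
Import Order.TTheory GRing.Theory Num.Theory.
Import numFieldNormedType.Exports.

Local Open Scope classical_set_scope.
Local Open Scope ring_scope.
Local Open Scope complex_scope.

(* Norms of complex normed spaces take values in R[i]; this is the same number
   seen as a real. *)
Definition rnorm (R : realType) (V : normedModType R[i]) (x : V) : R :=
  complex.Re `|x|.

Definition cabs (R : realType) (z : R[i]) : R := complex.Re `|z|.

Definition separable (T : topologicalType) : Prop :=
  exists S : set T, countable S /\ dense S.

Section Operators.
Context {R : realType} {H : completeNormedModType R[i]}.
Variable dot : {dot H for Num.conj}.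

(* A possibly unbounded operator T is represented by its graph: T (x, y) means
   that x belongs to the domain of T and that y is the value of T at x. *)
Definition domain (T : set (H * H)) : set H := [set x | exists y, T (x, y)].

Definition adjoint (T : set (H * H)) : set (H * H) :=
  [set q | forall p, T p -> dot p.2 q.1 = dot p.1 q.2].

(* A densely defined T has a single-valued and linear adjoint graph, so that
   T = T^* makes T a linear operator. *)
Definition self_adjoint (T : set (H * H)) : Prop :=
  dense (domain T) /\ T = adjoint T.

(* The order of R[i] compares numbers with the same imaginary part, so this
   includes that the quadratic form of T is real. *)
Definition bounded_from_below (T : set (H * H)) : Prop :=
  exists c : R, forall x y, T (x, y) -> c%:C * dot x x <= dot y x.

Definition bounded_operator (S : H -> H) : Prop := linear S /\ continuous S.

(* T (h, f + z *: h) says that h is in the domain of T and (T - z) h = f. *)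
Definition is_resolvent (T : set (H * H)) (z : R[i]) (S : H -> H) : Prop :=
  bounded_operator S /\ forall f h, T (h, f + z *: h) <-> h = S f.

Definition resolvent_set (T : set (H * H)) : set R[i] :=
  [set z | exists S, is_resolvent T z S].

Definition resolvent (T : set (H * H)) (z : R[i]) : H -> H :=
  get [set S | is_resolvent T z S].

Definition opnorm (S : H -> H) : R :=
  sup [set rnorm (S f) | f in [set f | rnorm f <= 1]].

Definition norm_resolvent_cvg (A : set (H * H))
    (Tn : nat -> set (H * H)) (T : set (H * H)) : Prop :=
  forall z, resolvent_set A z -> resolvent_set T z ->
    (\forall n \near \oo, resolvent_set (Tn n) z) /\
    opnorm (fun f => resolvent (Tn n) z f - resolvent T z f)
      @[n --> \oo] --> (0 : R).

End Operators.

Section ComplexMeasures.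
Context {R : realType}.
Implicit Types (nu : set (measurableTypeR R) -> R[i]) (f : R -> R).

Definition cmeasure_variation nu (D : set (measurableTypeR R)) : \bar R :=
  ereal_sup [set x | exists F : nat -> set (measurableTypeR R),
    [/\ forall k, measurable (F k), trivIset setT F, \bigcup_k F k = D &
        x = (\sum_(0 <= k <oo) (cabs (nu (F k)))%:E)%E]].

(* The value does not depend on the decomposition of nu into finite positive
   measures; if f is integrable with respect to the total variation of nu, one
   may take the Jordan decompositions of the real and imaginary parts of nu. *)
Definition cintegral nu f : R[i] :=
  get [set c : R[i]^o |
    exists p1 p2 p3 p4 : {finite_measure set (measurableTypeR R) -> \bar R},
    [/\ forall D, measurable D -> nu D =
          (fine (p1 D) - fine (p2 D)) +i* (fine (p3 D) - fine (p4 D)),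
        p1.-integrable setT (EFin \o f) /\ p2.-integrable setT (EFin \o f),
        p3.-integrable setT (EFin \o f) /\ p4.-integrable setT (EFin \o f) &
        c = (\int[p1]_t f t - \int[p2]_t f t)
              +i* (\int[p3]_t f t - \int[p4]_t f t)]].

End ComplexMeasures.

Section SpectralMeasure.
Context {R : realType} {H : completeNormedModType R[i]}.
Variable dot : {dot H for Num.conj}.
Implicit Types (E : set (measurableTypeR R) -> H -> H).

Record projection_valued_measure E : Prop := ProjectionValuedMeasure {
  pvm_bounded : forall D, measurable D -> bounded_operator (E D);
  pvm_adjoint : forall D, measurable D ->
    forall u v, dot (E D u) v = dot u (E D v);
  pvm_setI : forall D1 D2, measurable D1 -> measurable D2 ->
    forall u, E (D1 `&` D2) u = E D1 (E D2 u);
  pvm_setT : forall u, E setT u = u;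
  pvm_sigma_additive : forall F : nat -> set (measurableTypeR R),
    (forall k, measurable (F k)) -> trivIset setT F ->
    forall u, \sum_(k < n) E (F k) u @[n --> \oo] --> E (\bigcup_k F k) u
}.

(* (E(D)u, u) is real and nonnegative. *)
Definition spectral_distribution E (u : H) :
    set (measurableTypeR R) -> \bar R :=
  fun D => (complex.Re (dot (E D u) u))%:E.

Definition spectral_integral E (g : R -> R) (u : H) : \bar R :=
  (\int[spectral_distribution E u]_t (g t)%:E)%E.

(* A is the integral of t with respect to E; by polarization the quadratic form
   determines A on its domain. *)
Record spectral_measure_of (A : set (H * H)) E : Prop := SpectralMeasureOf {
  sm_pvm : projection_valued_measure E;
  sm_domain : forall u,
    domain A u <-> (spectral_integral E (fun t => t ^+ 2)%R u < +oo)%E;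
  sm_value : forall u y, A (u, y) ->
    dot y u = (fine (spectral_integral E id u))%:C
}.

(* g(A) for a bounded Borel function g, determined by its quadratic form. *)
Definition fun_calculus E (g : R -> R) : H -> H :=
  get [set T : H -> H | bounded_operator T /\
    forall u, dot (T u) u = (fine (spectral_integral E g u))%:C].

End SpectralMeasure.

Section ScaleOfSpaces.
Context {R : realType} {H Hm2 : completeNormedModType R[i]}.
Variables (dot : {dot H for Num.conj}) (iota : {linear H -> Hm2}).
Implicit Types (E : set (measurableTypeR R) -> H -> H) (w : Hm2).

(* Hm2, with the embedding iota, is the completion of H in the norm
   `|(|A| + I)^-1 f|. *)
Definition is_Hminus2 E : Prop :=
  (forall f, `|iota f| = `|fun_calculus dot E (fun t => (`|t| + 1)^-1) f|) /\
  dense (range iota).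

(* Extension by continuity along iota. *)
Definition extend (W : topologicalType) (T : H -> W) w : set W :=
  [set y | T f @[f --> filter_from (nbhs w) (fun V => iota @^-1` V)] --> y].

Definition ext_fun_calculus E (g : R -> R) w : H :=
  get (extend (fun_calculus dot E g) w).

(* The pairing of phi in H_{+2}, seen as an element of H, with w in H_{-2}. *)
Definition pairing (phi : H) w : R[i] :=
  get (extend (fun f => dot phi f : R[i]^o) w).

Definition nu E (w1 w2 : Hm2) : set (measurableTypeR R) -> R[i] :=
  let T := ext_fun_calculus E (fun t => (Num.sqrt (t ^+ 2 + 1))^-1) in
  fun D => dot (E D (T w2)) (T w1).

(* Absolute convergence of <w2, A(A^2+1)^-1 w1>, the integral of t with respect
   to nu E w1 w2. *)
Definition form_exists E (w1 w2 : Hm2) : Prop :=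
  (\int[cmeasure_variation (nu E w1 w2)]_t (`|t|)%:E < +oo)%E.

Definition form_value E (w1 w2 : Hm2) : R[i] := cintegral (nu E w1 w2) id.

(* <w2, (A - z)^-1 w1> exists: it is the integral of (t^2+1)/(t - conj z) with
   respect to nu, the conjugate coming from the antilinearity in the second
   argument. *)
Definition resolvent_form_exists E (w1 w2 : Hm2) (z : R[i]) : Prop :=
  (\int[cmeasure_variation (nu E w1 w2)]_t
     ((t ^+ 2 + 1) / cabs (t%:C - Num.conj z))%:E < +oo)%E.

(* A + alpha <., w1> w2 with the parameter tau standing for
   <w2, A(A^2+1)^-1 w1>. *)
Definition perturbation (A : set (H * H)) E (alpha tau : R[i]) (w1 w2 : Hm2) :
    set (H * H) :=
  let eta := ext_fun_calculus E (fun t => t / (t ^+ 2 + 1)) w2 in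
  let zeta := ext_fun_calculus E (fun t => (t ^+ 2 + 1)^-1) w2 in
  [set p | exists phi Aphi b, [/\ A (phi, Aphi),
     b = - alpha * (pairing phi w1 + b * tau) &
     p = (phi + b *: eta, Aphi - b *: zeta)]].

Definition singular_pair (w1 w2 : Hm2) : Prop :=
  [/\ ~ range iota w1, ~ range iota w2 & w1 <> w2].

Definition class_P (A : set (H * H)) E (alpha : R[i]) (w1 w2 : Hm2)
    (T : set (H * H)) : Prop :=
  [/\ singular_pair w1 w2, form_exists E w1 w2 &
      T = perturbation A E alpha (form_value E w1 w2) w1 w2].

Definition class_Ptau (A : set (H * H)) E (alpha tau : R[i]) (w1 w2 : Hm2)
    (T : set (H * H)) : Prop :=
  [/\ singular_pair w1 w2, ~ form_exists E w1 w2 &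
      T = perturbation A E alpha tau w1 w2].

End ScaleOfSpaces.

(* Main.v *)
Require Import Defs.
From HB Require Import structures.
From mathcomp Require Import all_boot all_order all_algebra.
From mathcomp Require Import complex.
From mathcomp Require Import all_classical all_reals all_analysis.
From mathcomp Require Import measurable_realfun zify ring lra.
Import Order.TTheory GRing.Theory Num.Theory.
Import numFieldNormedType.Exports.
Local Open Scope classical_set_scope.
Local Open Scope ring_scope.
Local Open Scope complex_scope.

(** Let J : H_{-2} -> H be the isomorphism extending (A^2 + 1)^(-1/2), and put
f = J w1, g = J w2.  The resolvent of A + alpha <., w1> w2 is given by Krein's
formula, whose coefficients depend continuously on (f, g) in H x H and on the
parameter tau.  Hence it suffices to find f_n -> f and g_n -> g outside the
domain of A for which the form exists and has the value tau exactly.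

Since f is not in the domain, the line splits into S and its complement so that
neither E(S) f nor E(S^c) f is in the domain.  Truncating the second part of f
gives f_n; a truncation of g plus a small multiple of E(S^c) f gives g_n.  The
measure (E(.) g_n, f_n) then has bounded support.  As f_n is not in the domain of
A = A^*, the functional u |-> (A u, f_n) is unbounded, so a small correction of
g_n in the domain moves the value of the form to tau. *)

(** The class in question demands two distinct vectors outside [H]. Under [J] the space [H] becomes
    the domain of [A], and truncations always land there, so truncating [f] and [g] directly is not
    allowed: each new vector must keep an unbounded part, and the two unbounded parts must not
    interact in the form.

    Continuity of Krein's formula comes from the splitting 1/(t - z) = t/(t^2 + 1) + (1 + z t)/((t -
    z)(t^2 + 1)). In the pairing of (A - z)^-1 w2 with w1 only the first term can diverge, and [tau]
    stands in its place; the second is continuous in [(f, g)]. The same formula therefore describes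
    both classes, with the same [tau] once the form has exactly that value.

    The spectral measure is tied to [A] only through the domain and the quadratic form. Bounded
    functions of [A] are built from it by quadratic forms, and [A] itself is compared with
    multiplication by t inside the windows [-n, n], where it is bounded. *)

Section RealNorm.
Context {R : realType}.
Implicit Types (V : normedModType R[i]) (a b : R[i]).

Lemma normE V (x : V) : `|x| = (rnorm x)%:C.
Proof. by rewrite /rnorm RRe_real// ger0_real. Qed.

Lemma rnorm_ge0 V (x : V) : 0 <= rnorm x.
Proof. by rewrite -ler0c -normE. Qed.

Lemma cabsE a : `|a| = (cabs a)%:C.
Proof. by rewrite /cabs RRe_real// ger0_real. Qed.

Lemma cabs_ge0 a : 0 <= cabs a.
Proof. by rewrite -ler0c -cabsE. Qed.

Lemma rnorm0 V : rnorm (0 : V) = 0.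
Proof. by rewrite /rnorm normr0. Qed.

Lemma rnorm_eq0 V (x : V) : rnorm x = 0 -> x = 0.
Proof. by move=> x0; apply/normr0_eq0; rewrite normE x0. Qed.

Lemma rnormD V (x y : V) : rnorm (x + y) <= rnorm x + rnorm y.
Proof. by rewrite -lecR rmorphD /= -!normE ler_normD. Qed.

Lemma rnormN V (x : V) : rnorm (- x) = rnorm x.
Proof. by rewrite /rnorm normrN. Qed.

Lemma rdistC V (x y : V) : rnorm (x - y) = rnorm (y - x).
Proof. by rewrite -rnormN opprB. Qed.

Lemma rnormB V (x y : V) : rnorm (x - y) <= rnorm x + rnorm y.
Proof. by rewrite -(rnormN V y) rnormD. Qed.

Lemma rnorm_dist V (x y z : V) : rnorm (x - z) <= rnorm (x - y) + rnorm (y - z).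
Proof. by have := rnormD V (x - y) (y - z); rewrite addrA subrK. Qed.

Lemma rnormZ V a (x : V) : rnorm (a *: x) = cabs a * rnorm x.
Proof. by apply: complexI; rewrite rmorphM /= -!normE -cabsE normrZ. Qed.

Lemma cabsM a b : cabs (a * b) = cabs a * cabs b.
Proof. by apply: complexI; rewrite rmorphM /= -!cabsE normrM. Qed.

Lemma cabsD a b : cabs (a + b) <= cabs a + cabs b.
Proof. by rewrite -lecR rmorphD /= -!cabsE ler_normD. Qed.

Lemma cabs0 : cabs (0 : R[i]) = 0.
Proof. by rewrite /cabs normr0. Qed.

Lemma cabs_eq0 a : cabs a = 0 -> a = 0.
Proof. by move=> a0; apply/normr0_eq0; rewrite cabsE a0. Qed.

Lemma cabsV a : cabs a^-1 = (cabs a)^-1.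
Proof. by apply: complexI; rewrite fmorphV /= -!cabsE normfV. Qed.

Lemma cabs_real (r : R) : cabs r%:C = `|r|.
Proof. by rewrite /cabs normc_def /= expr0n addr0 sqrtr_sqr. Qed.

Lemma Re_le_cabs a : `|complex.Re a| <= cabs a.
Proof. by rewrite -lecR -cabsE normc_ge_Re. Qed.

Lemma ReD a b : complex.Re (a + b) = complex.Re a + complex.Re b.
Proof. by case: a; case: b. Qed.

Lemma ReN a : complex.Re (- a) = - complex.Re a.
Proof. by case: a. Qed.

Lemma ReB a b : complex.Re (a - b) = complex.Re a - complex.Re b.
Proof. by rewrite ReD ReN. Qed.

Lemma cabs_rnorm a : cabs a = rnorm (a : R[i]^o).
Proof. by []. Qed.

(** A positive element of [R[i]] is real, so the epsilons in [R[i]] of a complex normed space can be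
    exchanged for real ones. *)
Lemma cvg_rnormP (T : Type) (F : set_system T) {FF : Filter F}
    V (f : T -> V) (l : V) :
  f x @[x --> F] --> l <-> rnorm (f x - l) @[x --> F] --> (0 : R).
Proof.
split=> h.
  apply/cvgr0Pnorm_lt => e e0.
  have e0' : 0 < e%:C by rewrite ltcR.
  move/cvgrPdist_lt: h => /(_ _ e0'); apply: filterS => x.
  rewrite normE ltcR rdistC => xe.
  by rewrite ger0_norm// rnorm_ge0.
apply/cvgrPdist_lt => e e0.
have eE : e = (complex.Re e)%:C by rewrite RRe_real// gtr0_real.
have e0' : 0 < complex.Re e by rewrite -ltcR -eE.
move/cvgr0Pnorm_lt: h => /(_ _ e0'); apply: filterS => x.
by rewrite ger0_norm ?rnorm_ge0// eE normE ltcR rdistC.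
Qed.

Lemma cvg_bound (T : Type) (F : set_system T) {FF : Filter F}
    V (f : T -> V) (l : V) (b : T -> R) :
  (\forall x \near F, rnorm (f x - l) <= b x) -> b x @[x --> F] --> (0 : R) ->
  f x @[x --> F] --> l.
Proof.
move=> fb b0; apply/cvg_rnormP.
apply: (@squeeze_cvgr _ F _ _ (fun=> 0) b); [|exact: cvg_cst|exact: b0].
by apply: filterS fb => x; rewrite rnorm_ge0.
Qed.

Lemma cvg_eps V (f : nat -> V) (l : V) :
  (forall e : R, 0 < e -> \forall n \near \oo, rnorm (f n - l) < e) ->
  f n @[n --> \oo] --> l.
Proof.
move=> h; apply/cvg_rnormP/cvgr0Pnorm_lt => e /h; apply: filterS => n.
by rewrite ger0_norm// rnorm_ge0.
Qed.

Lemma cvg_epsE (T : Type) (F : set_system T) {FF : Filter F} V (f : T -> V) (l : V) :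
  f n @[n --> F] --> l ->
  (forall e : R, 0 < e -> \forall n \near F, rnorm (f n - l) < e).
Proof.
move=> /cvg_rnormP/cvgr0Pnorm_lt h e /h; apply: filterS => n.
by rewrite ger0_norm// rnorm_ge0.
Qed.

(** Identities of quadratic forms are later obtained as limits of approximations with error 2^-n. *)
Lemma le_eps_eq0 (x C : R) : 0 <= x -> (forall n, x <= 2^-1 ^+ n * C) -> x = 0.
Proof.
move=> x0 h; apply/eqP; rewrite eq_le x0 andbT.
have : (2^-1 ^+ n * C : R) @[n --> \oo] --> (0 * C : R).
  apply: cvgM; last exact: cvg_cst.
  by apply: cvg_expr; rewrite ger0_norm//; lra.
rewrite mul0r => hc.
by apply: (cvgr_to_ge hc); exact: nearW.
Qed.

End RealNorm.

(** * Hilbert space geometry, polarization and bounded operators *)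

Section Hilbert.
Context {R : realType} {H : completeNormedModType R[i]} {dot : {dot H for Num.conj}}.
Context (norm_dot : forall u : H, `|u| ^+ 2 = dot u u).
Implicit Types (u v w : H) (S T : H -> H).

Definition lip T := exists2 C : R, 0 <= C & forall u, rnorm (T u) <= C * rnorm u.

Lemma dotC u v : dot u v = Num.conj (dot v u).
Proof. by rewrite hermC expr0 mul1r. Qed.

Lemma dotDl u v w : dot (u + v) w = dot u w + dot v w.
Proof. exact: linearDl. Qed.
Lemma dotBl u v w : dot (u - v) w = dot u w - dot v w.
Proof. exact: linearBl. Qed.
Lemma dotZl a u v : dot (a *: u) v = a * dot u v.
Proof. exact: linearZl_LR. Qed.
Lemma dot0l u : dot 0 u = 0.
Proof. exact: linear0l. Qed.
Lemma dotDr u v w : dot u (v + w) = dot u v + dot u w.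
Proof. exact: linearDr. Qed.
Lemma dotBr u v w : dot u (v - w) = dot u v - dot u w.
Proof. exact: linearBr. Qed.
Lemma dotZr a u v : dot u (a *: v) = Num.conj a * dot u v.
Proof. exact: linearZr_LR. Qed.
Lemma dot0r u : dot u 0 = 0.
Proof. exact: linear0r. Qed.

Lemma dotE u : dot u u = (rnorm u ^+ 2)%:C.
Proof. by rewrite -norm_dot normE rmorphXn. Qed.

Lemma Re_dot u : complex.Re (dot u u) = rnorm u ^+ 2.
Proof. by rewrite dotE. Qed.

(** The squared norm of |v|^2 u - (u, v) v equals |v|^2 (|v|^2 |u|^2 - |(u, v)|^2), and it is
    nonnegative. *)
Lemma cauchy_schwarz u v : cabs (dot u v) <= rnorm u * rnorm v.
Proof.
have [->|v0] := eqVneq v 0; first by rewrite dot0r cabs0 rnorm0 mulr0.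
have nv0 : rnorm v != 0 by apply: contra_neq v0 => /rnorm_eq0.
have nv : 0 < rnorm v by rewrite lt_neqAle eq_sym nv0 rnorm_ge0.
set d := dot u v; pose c : R[i] := (rnorm v ^+ 2)%:C.
have c0 : c != 0 by rewrite eq_complex /= eqxx andbT sqrf_eq0.
have : 0 <= complex.Re (dot (c *: u - d *: v) (c *: u - d *: v)).
  by rewrite Re_dot sqr_ge0.
have -> : dot (c *: u - d *: v) (c *: u - d *: v) =
    (rnorm v ^+ 2 * (rnorm v ^+ 2 * rnorm u ^+ 2 - cabs d ^+ 2))%:C.
  rewrite !(dotBl, dotBr, dotZl, dotZr) !dotE (dotC v u) -/d.
  have -> : Num.conj c = c by rewrite /c; apply/CrealP; rewrite complex_real.
  have : ((cabs d ^+ 2)%:C = d * Num.conj d) by rewrite rmorphXn /= -cabsE normCK.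
  rewrite /c; move: (rnorm v ^+ 2) (rnorm u ^+ 2) (cabs d ^+ 2) => a b e eE.
  by rewrite rmorphM rmorphB rmorphM /= eE; ring.
rewrite /= pmulr_rge0 ?exprn_gt0// subr_ge0 -exprMn mulrC.
by rewrite ler_sqr// nnegrE ?mulr_ge0 ?cabs_ge0 ?rnorm_ge0.
Qed.

Lemma dot_cvg (F : set_system nat) {FF : Filter F} (f g : nat -> H) u v :
  f n @[n --> F] --> u -> g n @[n --> F] --> v ->
  (dot (f n) (g n) : R[i]^o) @[n --> F] --> (dot u v : R[i]^o).
Proof.
move=> fu gv; have /cvg_rnormP fu0 := fu; have /cvg_rnormP gv0 := gv.
apply: (@cvg_bound _ _ _ _ _ _ _ (fun n =>
  rnorm (f n - u) * (rnorm v + rnorm (g n - v)) + rnorm u * rnorm (g n - v))).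
  apply: nearW => n; rewrite -cabs_rnorm.
  have -> : dot (f n) (g n) - dot u v =
    (dot (f n - u) v + dot (f n - u) (g n - v)) + dot u (g n - v).
    by rewrite !(dotBl, dotBr); ring.
  rewrite (le_trans (cabsD _ _))// lerD ?cauchy_schwarz//.
  by rewrite (le_trans (cabsD _ _))// mulrDr lerD ?cauchy_schwarz.
rewrite (_ : 0 = 0 * (rnorm v + 0) + rnorm u * 0); last by ring.
apply: cvgD; apply: cvgM => //; last exact: cvg_cst.
by apply: cvgD => //; exact: cvg_cst.
Qed.

(** The polarization sum, equal to four times the sesquilinear form with diagonal [q]; the sign of
    the last term suits antilinearity in the second argument. *)
Definition pol (q : H -> R[i]) u v :=
  q (u + v) - q (u - v) + 'i%C * (q (u + 'i%C *: v) - q (u - 'i%C *: v)).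

Lemma conj_i : Num.conj ('i%C : R[i]) = - 'i%C.
Proof. by rewrite complexiE conjCi. Qed.

Lemma polarization (B : H -> H -> R[i]) u v :
  (forall x y z, B (x + y) z = B x z + B y z) ->
  (forall x y z, B z (x + y) = B z x + B z y) ->
  (forall a x y, B (a *: x) y = a * B x y) ->
  (forall a x y, B x (a *: y) = Num.conj a * B x y) ->
  pol (fun x => B x x) u v = 4%:R * B u v.
Proof.
move=> Dl Dr Zl Zr.
have Nl x y : B (- x) y = - B x y by rewrite -scaleN1r Zl mulN1r.
have Nr x y : B x (- y) = - B x y by rewrite -scaleN1r Zr rmorphN rmorph1 mulN1r.
rewrite /pol !(Dl, Dr, Nl, Nr, Zl, Zr) conj_i.
have i2 : 'i%C * 'i%C = -1 :> R[i] by rewrite -expr2 sqr_i.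
ring: i2.
Qed.

Section Lin.
Context (T : H -> H) (lT : linear T).
Let T' : {linear H -> H} := HB.pack T (GRing.isLinear.Build _ _ _ _ T lT).

Lemma op0 : T 0 = 0. Proof. exact: (linear0 T'). Qed.
Lemma opD u v : T (u + v) = T u + T v. Proof. exact: (linearD T'). Qed.
Lemma opB u v : T (u - v) = T u - T v. Proof. exact: (linearB T'). Qed.
Lemma opN u : T (- u) = - T u. Proof. exact: (linearN T'). Qed.
Lemma opZ a u : T (a *: u) = a *: T u. Proof. exact: (linearZ_LR T'). Qed.

Lemma lip_cvg (G : Type) (F : set_system G) {FF : Filter F} (f : G -> H) l :
  lip T -> f x @[x --> F] --> l -> T (f x) @[x --> F] --> T l.
Proof.
move=> [C C0 TC] /cvg_rnormP fl.
apply: (@cvg_bound _ _ _ _ _ _ _ (fun x => C * rnorm (f x - l))).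
  by apply: nearW => x; rewrite -opB.
rewrite -[X in _ --> X](mulr0 C); apply: cvgM => //; exact: cvg_cst.
Qed.

Lemma lip_bounded_operator : lip T <-> bounded_operator T.
Proof.
split=> [lT'|[_ cT]].
  by split=> // x; exact: (@lip_cvg _ (nbhs x) _ id x lT' cvg_id).
have /linear_boundedP : bounded_near T' (nbhs (0 : H)).
  exact/linear_bounded_continuous.
move=> /pinfty_ex_gt0[r r0 Tr].
have rE : r = (complex.Re r)%:C by rewrite RRe_real// gtr0_real.
exists (complex.Re r); first by rewrite -ler0c -rE ltW.
by move=> u; rewrite -lecR rmorphM /= -!normE -rE; exact: Tr.
Qed.

End Lin.

Let n4 : 4%:R != 0 :> R[i]. Proof. by rewrite pnatr_eq0. Qed.

(** Over the complex numbers polarization recovers (S u, v) from the quadratic form. This makes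
    operators selected by their quadratic form, such as [fun_calculus], unique. *)
Lemma op_eq S T : linear S -> linear T ->
  (forall u, dot (S u) u = dot (T u) u) -> S = T.
Proof.
move=> lS lT ST; apply/funext => u; apply/eqP; rewrite -subr_eq0; apply/eqP.
have h v : dot (S u) v = dot (T u) v.
  have P Q (lQ : linear Q) : pol (fun x => dot (Q x) x) u v = 4%:R * dot (Q u) v.
    by apply: (polarization (fun x y => dot (Q x) y)) => *;
      rewrite ?opD ?opZ// ?dotDl ?dotDr ?dotZl ?dotZr.
  have := P _ lS; rewrite (_ : (fun x => _) = (fun x => dot (T x) x)); last exact/funext.
  by rewrite (P _ lT) => /(mulfI n4) ->.
by apply: rnorm_eq0; apply/eqP; rewrite -sqrf_eq0 -Re_dot dotBl h subrr /= eqxx.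
Qed.

Lemma op_sym T : linear T -> (forall u, complex.Im (dot (T u) u) = 0) ->
  forall u v, dot (T u) v = dot u (T v).
Proof.
move=> lT rT u v.
have P1 : pol (fun x => dot (T x) x) u v = 4%:R * dot (T u) v.
  by apply: (polarization (fun x y => dot (T x) y)) => *;
      rewrite ?opD ?opZ// ?dotDl ?dotDr ?dotZl ?dotZr.
have P2 : pol (fun x => dot x (T x)) u v = 4%:R * dot u (T v).
  by apply: (polarization (fun x y => dot x (T y))) => *;
      rewrite ?opD ?opZ// ?dotDl ?dotDr ?dotZl ?dotZr.
have E : (fun x => dot x (T x)) = (fun x => dot (T x) x).
  apply/funext => x; rewrite dotC; apply/CrealP.
  by case: (dot (T x) x) (rT x) => a b /= ->; rewrite complex_real.
by move: P2; rewrite E P1 => /(mulfI n4) ->.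
Qed.

Lemma dot_ext u v : (forall w, dot u w = dot v w) -> u = v.
Proof.
move=> h; apply/eqP; rewrite -subr_eq0; apply/eqP; apply: rnorm_eq0.
by apply/eqP; rewrite -sqrf_eq0 -Re_dot dotBl h subrr /= eqxx.
Qed.

Lemma lip_comp S T : lip S -> lip T -> lip (S \o T).
Proof.
move=> [C C0 SC] [D D0 TD]; exists (C * D); first exact: mulr_ge0.
by move=> u /=; rewrite (le_trans (SC _))// -mulrA ler_wpM2l.
Qed.

Lemma linear_comp S T : linear S -> linear T -> linear (S \o T).
Proof. by move=> lS lT a u v /=; rewrite lT lS. Qed.

Lemma lin_comb a S T : linear S -> linear T -> linear (fun u => a *: S u + T u).
Proof.
move=> lS lT b u v; rewrite lS lT !scalerDr !scalerA (mulrC a b) addrACA.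
by [].
Qed.

Lemma lip_comb a S T : lip S -> lip T -> lip (fun u => a *: S u + T u).
Proof.
move=> [C C0 SC] [D D0 TD]; exists (cabs a * C + D).
  by rewrite addr_ge0 ?mulr_ge0 ?cabs_ge0.
move=> u; rewrite (le_trans (rnormD _ _ _))// rnormZ mulrDl lerD// -mulrA.
by rewrite ler_wpM2l ?cabs_ge0.
Qed.

End Hilbert.

(** * Integrals against set functions that need not be measures *)

Section SetFunctionIntegral.
Context d {T : measurableType d} {R : realType}.
Implicit Types (m : set T -> \bar R).
Local Open Scope ereal_scope.
Import HBNNSimple.

(** The integral is defined through simple functions, which see a set function only on measurable
    sets. It is applied to [spectral_distribution], which carries no measure structure. *)
Lemma eq_set_function_integral m1 m2 (f : T -> \bar R) :
  (forall D, measurable D -> m1 D = m2 D) ->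
  \int[m1]_t f t = \int[m2]_t f t.
Proof.
move=> m12.
have E (h : {nnsfun T >-> R}) : sintegral m1 h = sintegral m2 h.
  by rewrite /sintegral; apply: eq_fsbigr => x _; rewrite m12.
rewrite /integral /=; congr (ereal_sup _ - ereal_sup _);
  by apply/seteqP; split=> _ [h hf <-]; exists h.
Qed.

(** Meant for the total variation, whose additivity is never established here: the comparison is
    made on simple functions and then passed to suprema. *)
Lemma le_set_function_integral m1 (m2 : {measure set T -> \bar R}) (f : T -> \bar R) :
  m1 set0 = 0 -> (forall D, measurable D -> 0 <= m1 D <= m2 D) ->
  (forall t, 0 <= f t) ->
  \int[m1]_t f t <= \int[m2]_t f t.
Proof.
move=> m10 m12 f0.
have le_s (h : {nnsfun T >-> R}) : sintegral m1 h <= sintegral m2 h.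
  (* Values outside the range of [h] have empty preimage, so [m1 set0 = 0] removes them from the
     sum. *)
  rewrite [leRHS]sintegralE /sintegral -(fsbig_widen (range h) setT)//=; last first.
    by move=> x [_ Nhx] /=; rewrite preimage10// m10 mule0.
  apply: lee_fsum => // r [t _ <-].
  apply: lee_wpmul2l; rewrite ?lee_fin//.
  by have /andP[] := m12 _ (measurable_funPTI h (measurable_set1 (h t))).
rewrite [leRHS]ge0_integralTE// /integral /= funepos_restrict funeneg_restrict !patch_setT.
rewrite (_ : f^\+ = f); last by apply/funext => t; rewrite (@ge0_funeposE _ _ setT)// inE.
apply: (@le_trans _ _ (ereal_sup [set sintegral m1 h | h in
    [set h : {nnsfun T >-> R} | forall x, (h x)%:E <= f x]])).
  (* The integral against [m1] still subtracts the supremum for the negative part of [f]; the zero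
     function shows that this supremum is at least 0. *)
  rewrite -[leRHS]adde0; apply: leeD => //; rewrite leeNl oppe0.
  apply: ereal_sup_ubound; exists nnsfun0 => /=.
    by move=> t; rewrite funenegE le_max lexx orbT.
  by rewrite /sintegral fsbig1// => r _; rewrite preimage_cst; case: ifPn => [|_];
    [rewrite inE => <-; rewrite mul0e|rewrite m10 mule0].
apply: ge_ereal_sup => _ [h hf <-]; apply: (le_trans (le_s h)).
by apply: ereal_sup_ubound; exists h.
Qed.

End SetFunctionIntegral.

(** * Projection-valued measures and the scalar spectral measures *)

Section Pvm.
Context {R : realType} {H : completeNormedModType R[i]} {dot : {dot H for Num.conj}}.
Context (norm_dot : forall u : H, `|u| ^+ 2 = dot u u).
Context {E : set (measurableTypeR R) -> H -> H}.
Context (pE : projection_valued_measure dot E).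
Implicit Types (u v w : H) (S T : H -> H) (D : set (measurableTypeR R)).

Lemma pvm_op D : measurable D -> bounded_operator (E D).
Proof. exact: (pvm_bounded pE). Qed.

Lemma pvm_linear D : measurable D -> linear (E D).
Proof. by move=> /pvm_op[]. Qed.

Lemma pvmI D1 D2 : measurable D1 -> measurable D2 ->
  forall u, E D1 (E D2 u) = E (D1 `&` D2) u.
Proof. by move=> m1 m2 u; rewrite (pvm_setI pE). Qed.

Lemma pvm_idem D : measurable D -> forall u, E D (E D u) = E D u.
Proof. by move=> mD u; rewrite pvmI// setIid. Qed.

Lemma pvm_dot D : measurable D ->
  forall u v, dot (E D u) v = dot (E D u) (E D v).
Proof. by move=> mD u v; rewrite -[in LHS]pvm_idem// (pvm_adjoint pE). Qed.

(** Cauchy-Schwarz applied to |E(D) u|^2 = (u, E(D) u). *)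
Lemma pvm_contract D : measurable D -> forall u, rnorm (E D u) <= rnorm u.
Proof.
move=> mD u; have := cauchy_schwarz norm_dot u (E D u).
rewrite -(pvm_adjoint pE)// pvm_dot// (dotE norm_dot) cabs_real ger0_norm ?sqr_ge0//.
have [->|n0] := eqVneq (rnorm (E D u)) 0; first by rewrite rnorm_ge0.
by rewrite expr2 ler_pM2r// lt_neqAle eq_sym n0 rnorm_ge0.
Qed.

Lemma pvm_lip D : measurable D -> lip (E D).
Proof. by move=> mD; exists 1 => // u; rewrite mul1r pvm_contract. Qed.

(** Sigma-additivity for the constant sequence of empty sets: consecutive partial sums differ by
    [E set0 u] and have the same limit. *)
Lemma pvm_set0 u : E set0 u = 0.
Proof.
have h := @pvm_sigma_additive _ _ _ _ pE (fun=> set0) (fun=> @measurable0 _ _) _ u.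
have {}h : \sum_(k < n) E set0 u @[n --> \oo] --> E set0 u.
  have U0 : \bigcup_(k : nat) (set0 : set (measurableTypeR R)) = set0 by exact: bigcup0.
  by rewrite -[X in _ --> E X u]U0; apply: h; exact: trivIset_set0.
have h1 : \sum_(k < n.+1) E set0 u @[n --> \oo] --> E set0 u.
  by rewrite (cvg_shiftS (fun n => \sum_(k < n) E set0 u)).
have h2 : E set0 u @[_ --> \oo] --> E set0 u - E set0 u.
  apply: cvg_trans (cvgB h1 h); apply: near_eq_cvg; apply: nearW => n /=.
  by rewrite !fctE big_ord_recr/= addrAC subrr add0r.
rewrite subrr in h2.
exact: (cvg_unique (@norm_hausdorff _ H) (cvg_cst (E set0 u)) h2).
Qed.

(* The proofs are arguments so that the measure structure can be attached to
   specm_fun; the case distinction makes the function nonnegative everywhere. *)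
Definition specm_fun (_ : forall u : H, `|u| ^+ 2 = dot u u)
    (_ : projection_valued_measure dot E) u D : \bar R :=
  if `[< measurable D >] then (rnorm (E D u) ^+ 2)%:E else 0%E.

Lemma specm_funE u D : measurable D -> specm_fun norm_dot pE u D = (rnorm (E D u) ^+ 2)%:E.
Proof. by move=> mD; rewrite /specm_fun asboolT. Qed.

Let specm_fun0 u : specm_fun norm_dot pE u set0 = 0%E.
Proof. by rewrite specm_funE// pvm_set0 rnorm0 expr0n. Qed.

Let specm_fun_ge0 u D : (0 <= specm_fun norm_dot pE u D)%E.
Proof. by rewrite /specm_fun; case: ifP => // _; rewrite lee_fin sqr_ge0. Qed.

Lemma Re_dot_pvm D u : measurable D -> complex.Re (dot (E D u) u) = rnorm (E D u) ^+ 2.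
Proof. by move=> mD; rewrite pvm_dot// (Re_dot norm_dot). Qed.

(** Pairing the convergent sums of vectors with [u] turns sigma-additivity of [E] into that of (E(D)
    u, u) = |E(D) u|^2. *)
Let specm_fun_sigma u : semi_sigma_additive (specm_fun norm_dot pE u).
Proof.
move=> F mF tF mUF; rewrite specm_funE// -Re_dot_pvm//.
have -> : (fun n => (\sum_(0 <= i < n) specm_fun norm_dot pE u (F i))%E) =
    EFin \o (fun n => complex.Re (dot (\sum_(k < n) E (F k) u) u)).
  apply/funext; elim=> [|n IH] /=; first by rewrite big_geq// big_ord0 dot0l.
  rewrite big_nat_recr//= IH /= big_ord_recr/= specm_funE// -Re_dot_pvm//.
  by rewrite -EFinD dotDl ReD.
apply/cvg_EFin; first exact: nearW.
have /(dot_cvg norm_dot) := @pvm_sigma_additive _ _ _ _ pE F mF tF u.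
move=> /(_ (fun=> u) u (cvg_cst _)) /cvg_rnormP h.
have h' : complex.Re (dot (\sum_(k < n) E (F k) u) u) @[n --> \oo] -->
   complex.Re (dot (E (\bigcup_n F n) u) u).
  apply/cvgrPdist_lt => e e0; move/cvgr0Pnorm_lt : h => /(_ _ e0).
  apply: filterS => n; rewrite ger0_norm ?rnorm_ge0//; apply: le_lt_trans.
  by rewrite distrC -ReB; exact: Re_le_cabs.
exact: h'.
Qed.

Let specm_fun_fin u : fin_num_fun (specm_fun norm_dot pE u).
Proof. by move=> D mD; rewrite specm_funE. Qed.

HB.instance Definition _ u := isMeasure.Build _ _ _ (specm_fun norm_dot pE u)
  (specm_fun0 u) (specm_fun_ge0 u) (@specm_fun_sigma u).

HB.instance Definition _ u := Measure_isFinite.Build _ _ _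
  (specm_fun norm_dot pE u) (specm_fun_fin u).

Definition specm u : {finite_measure set (measurableTypeR R) -> \bar R} :=
  specm_fun norm_dot pE u.

Lemma specmE u D : measurable D ->
  (specm u : {measure set (measurableTypeR R) -> \bar R}) D = (rnorm (E D u) ^+ 2)%:E.
Proof. exact: specm_funE. Qed.

Lemma spectral_integralE (g : R -> R) u :
  spectral_integral dot E g u = (\int[specm u]_t (g t)%:E)%E.
Proof.
apply: eq_set_function_integral => D mD.
by rewrite specmE// /spectral_distribution Re_dot_pvm.
Qed.

End Pvm.

(** * Bounded Borel functions and their uniform approximation by simple ones *)

Section BoundedMeasurable.
Context {R : realType}.
Implicit Types (g h : measurableTypeR R -> R) (D : set (measurableTypeR R)).

(** The bound [K] is positive so that it can be divided by when [g] is rescaled to values in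
    [0, 1]. *)
Definition bmf g := measurable_fun setT g /\ exists2 K, 0 < K & forall t, `|g t| <= K.

Lemma bmf_indic D : measurable D -> bmf \1_D.
Proof.
move=> mD; split; first exact: measurable_indic.
by exists 1 => // t; rewrite indicE; case: (_ \in _); rewrite ?normr1 ?normr0.
Qed.

Lemma bmf_comb a g h : bmf g -> bmf h -> bmf (fun t => a * g t + h t).
Proof.
move=> [mg [K K0 gK]] [mh [L L0 hL]]; split.
  by apply: measurable_funD => //; apply: measurable_funM => //; exact: measurable_cst.
exists (`|a| * K + L); first by rewrite ltr_wpDl// mulr_ge0// ltW.
by move=> t; rewrite (le_trans (ler_normD _ _))// normrM lerD// ler_wpM2l.
Qed.

Lemma bmfM g h : bmf g -> bmf h -> bmf (fun t => g t * h t).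
Proof.
move=> [mg [K K0 gK]] [mh [L L0 hL]]; split; first exact: measurable_funM.
by exists (K * L); rewrite ?mulr_gt0// => t; rewrite normrM ler_pM.
Qed.

Lemma bmf_cst a : bmf (fun=> a).
Proof.
split; first exact: measurable_cst.
by exists (`|a| + 1) => [|t]; rewrite ?ltr_wpDl// lerDl.
Qed.

Lemma bmfB g h : bmf g -> bmf h -> bmf (fun t => g t - h t).
Proof.
move=> bg bh; have := bmf_comb (-1) _ _ bh bg; congr bmf.
by apply/funext => t; ring.
Qed.

Lemma bmf_integrable (m : {finite_measure set (measurableTypeR R) -> \bar R}) g :
  bmf g -> m.-integrable setT (EFin \o g).
Proof.
move=> [mg [K _ gK]]; apply: measurable_bounded_integrable => //.
  by rewrite ltey_eq fin_num_measure.
exists K; split; first exact: num_real.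
by move=> x Kx t _ /=; rewrite (le_trans (gK t))// ltW.
Qed.

(* Binary digits: g = 1/2 1_D + 1/2 g' with D = {g >= 1/2} and g' again with
   values in [0, 1]. *)
Lemma simple_approx (P : (measurableTypeR R -> R) -> Prop) g :
  (forall D, measurable D -> P \1_D) ->
  (forall a f h, P f -> P h -> P (fun t => a * f t + h t)) ->
  measurable_fun setT g -> (forall t, 0 <= g t <= 1) ->
  forall n, exists2 s, P s & forall t, `|g t - s t| <= 2^-1 ^+ n.
Proof.
move=> P1 Pcomb mg g01 n.
have P0 : P (fun=> 0).
  by have := P1 _ measurable0; congr P; apply/funext => t; rewrite indic0.
elim: n g mg g01 => [|n IH] g mg g01.
  exists (fun=> 0) => // t; rewrite subr0 expr0.
  by have /andP[g0 g1] := g01 t; rewrite ger0_norm.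
pose D := [set t | 2^-1 <= g t].
have mD : measurable D.
  have -> : D = g @^-1` `[2^-1, +oo[%classic.
    by apply/seteqP; split=> t /=; rewrite in_itv/= andbT.
  by rewrite -[X in measurable X]setTI; apply: mg.
pose g' t := 2 * g t + (-1) * \1_D t.
have mg' : measurable_fun setT g'.
  by apply: measurable_funD; apply: measurable_funM => //; exact: measurable_indic.
have [t|s Ps s_g'] := IH g' mg'.
  have /andP[g0 g1] := g01 t; rewrite /g' indicE.
  by have [|] := boolP (t \in D); rewrite ?inE ?notin_setE /D /= => ?; lra.
exists (fun t => 2^-1 * s t + (2^-1 * \1_D t + 0)).
  exact: (Pcomb _ _ _ Ps (Pcomb _ _ _ (P1 _ mD) P0)).
move=> t; have -> : g t - (2^-1 * s t + (2^-1 * \1_D t + 0)) = 2^-1 * (g' t - s t).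
  by rewrite /g'; field.
by rewrite normrM exprS ger0_norm ?ler_pM2l//; lra.
Qed.

End BoundedMeasurable.

(** * The bounded Borel functional calculus *)

Section FunctionalCalculus.
Context {R : realType} {H : completeNormedModType R[i]} {dot : {dot H for Num.conj}}.
Context (norm_dot : forall u : H, `|u| ^+ 2 = dot u u).
Context {E : set (measurableTypeR R) -> H -> H}.
Context (pE : projection_valued_measure dot E).
Implicit Types (u v w : H) (S T : H -> H) (D : set (measurableTypeR R)).
Implicit Types (g h : measurableTypeR R -> R).

Local Notation mu := (specm norm_dot pE).

(** The measure [mu (E D u)] vanishes off [D] and agrees with [mu u] on measurable subsets of
    [D]. *)
Lemma specm_restr D u (f : measurableTypeR R -> \bar R) :
  measurable D -> measurable_fun setT f ->
  (\int[mu (E D u)]_t f t = \int[mu u]_(t in D) f t)%E.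
Proof.
move=> mD mf; have mDC := measurableC mD.
rewrite -(setUv D) integral_setU//; last 2 first.
- exact: measurable_funTS.
- by apply/disj_setPS => t [].
rewrite [X in (_ + X)%E]null_set_integral//; last 2 first.
- exact: measurable_funTS.
- by rewrite specmE// (pvmI pE)// setICl (pvm_set0 pE) rnorm0 expr0n.
rewrite adde0; apply: eq_measure_integral => A mA AD.
by rewrite !specmE// (pvmI pE)// (setIidl AD).
Qed.

Lemma specm_agree D u v (f : measurableTypeR R -> \bar R) : measurable D ->
  E D u = E D v -> (\int[mu u]_(t in D) f t = \int[mu v]_(t in D) f t)%E.
Proof.
move=> mD uv; apply: eq_measure_integral => A mA AD.
by rewrite !specmE// -(setIidl AD) -!(pvmI pE)// uv.
Qed.

Lemma specmT u : mu u setT = (rnorm u ^+ 2)%:E.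
Proof. by rewrite specmE// (pvm_setT pE). Qed.

Definition fc_form g u : R := \int[mu u]_t g t.

Lemma fc_form_comb a g h u : bmf g -> bmf h ->
  fc_form (fun t => a * g t + h t) u = a * fc_form g u + fc_form h u.
Proof.
move=> bg bh; rewrite /fc_form RintegralD//; first by rewrite RintegralZl//; exact: bmf_integrable.
- have := bmf_integrable (mu u) _ (bmf_comb a _ _ bg (bmf_cst 0)).
  by congr integrable; apply/funext => t /=; rewrite addr0.
- exact: bmf_integrable.
Qed.

Lemma fc_form_bound g u K : measurable_fun setT g -> (forall t, `|g t| <= K) ->
  `|fc_form g u| <= K * rnorm u ^+ 2.
Proof.
move=> mg gK.
have bg : bmf g.
  by split => //; exists (`|K| + 1) => [|t]; rewrite ?ltr_wpDl//
    (le_trans (gK t))// (le_trans (ler_norm K))// lerDl.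
rewrite /fc_form (le_trans (le_normr_Rintegral _ (bmf_integrable (mu u) _ bg)))//.
have -> : K * rnorm u ^+ 2 = \int[mu u]_t K by rewrite Rintegral_cst//= specmT.
apply: le_Rintegral => //.
  by apply: (integrable_norm (bmf_integrable (mu u) _ bg)) => //.
exact: (bmf_integrable (mu u) _ (bmf_cst K)).
Qed.

(** The quadratic form alone determines the operator ([fc_uniq]). Commutation with [E] is carried
    along because the proof of multiplicativity starts from (T E(D) u, u) = (T E(D) u, E(D) u). *)
Definition is_fc g T := [/\ linear T, lip T,
  forall D, measurable D -> forall u, E D (T u) = T (E D u) &
  forall u, dot (T u) u = (fc_form g u)%:C].

Lemma fc_indic D : measurable D -> is_fc \1_D (E D).
Proof.
move=> mD; split; [exact: (pvm_linear pE)|exact: (pvm_lip norm_dot pE)| |].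
- by move=> D' mD' u; rewrite !(pvmI pE)// setIC.
- by move=> u; rewrite (pvm_dot pE)// (dotE norm_dot) /fc_form /Rintegral
    integral_indic// setIT specmE.
Qed.

Lemma fc_comb a g h S T : bmf g -> bmf h -> is_fc g S -> is_fc h T ->
  is_fc (fun t => a * g t + h t) (fun u => a%:C *: S u + T u).
Proof.
move=> bg bh [lS bS cS qS] [lT bT cT qT]; split.
- exact: lin_comb.
- exact: lip_comb.
- by move=> D mD u; rewrite (pvm_linear pE)// cS// cT.
- by move=> u; rewrite dotDl dotZl qS qT fc_form_comb// rmorphD rmorphM.
Qed.

Lemma fc_uniq g S T : is_fc g S -> is_fc g T -> S = T.
Proof.
move=> [lS _ _ qS] [lT _ _ qT]; apply: (op_eq norm_dot) => // u.
by rewrite qS qT.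
Qed.

Lemma fc_sym g T : is_fc g T -> forall u v, dot (T u) v = dot u (T v).
Proof. by move=> [lT _ _ qT]; apply: op_sym => // u; rewrite qT. Qed.

(** Multiplicativity is not yet available, so the bound is read off the quadratic form: by symmetry
    of [T], 4 Re (T u, v) is the form at u + v minus the form at u - v, hence at most K (2 |u|^2 + 2
    |v|^2). *)
Lemma fc_bound g T K : 0 < K -> measurable_fun setT g -> (forall t, `|g t| <= K) ->
  is_fc g T -> forall u, rnorm (T u) <= K * rnorm u.
Proof.
move=> K0 mg gK fT u; have sT := fc_sym _ _ fT; have [lT _ _ qT] := fT.
have key v : 4 * complex.Re (dot (T u) v) <= K * (2 * rnorm u ^+ 2 + 2 * rnorm v ^+ 2).
  have -> : 4 * complex.Re (dot (T u) v) = fc_form g (u + v) - fc_form g (u - v).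
    have -> : fc_form g (u + v) - fc_form g (u - v) =
        complex.Re (dot (T (u + v)) (u + v) - dot (T (u - v)) (u - v)).
      by rewrite !qT -rmorphB.
    have -> : dot (T (u + v)) (u + v) - dot (T (u - v)) (u - v) =
        2 * dot (T u) v + 2 * dot (T v) u.
      rewrite (opD _ lT u v) (opB _ lT u v) !(dotBl, dotBr, dotDl, dotDr); ring.
    have -> : dot (T v) u = Num.conj (dot (T u) v) by rewrite sT dotC.
    case: (dot (T u) v) => a b; rewrite ReD.
    have -> : Num.conj (a +i* b) = a -i* b by [].
    have -> : (2 : R[i]) = 2%:C by rewrite rmorph_nat.
    by rewrite /=; ring.
  have := fc_form_bound g (u + v) K mg gK; have := fc_form_bound g (u - v) K mg gK.
  have -> : 2 * rnorm u ^+ 2 + 2 * rnorm v ^+ 2 =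
      rnorm (u + v) ^+ 2 + rnorm (u - v) ^+ 2.
    rewrite -!(Re_dot norm_dot) !(dotBl, dotBr, dotDl, dotDr) !(ReB, ReD).
    by ring.
  by rewrite !ler_norml mulrDr => /andP[? ?] /andP[? ?]; lra.
(* The choice v = T u / K yields 4 |T u|^2 / K <= 2 K |u|^2 + 2 |T u|^2 / K. *)
have := key ((K^-1)%:C *: T u).
rewrite dotZr rnormZ cabs_real gtr0_norm ?invr_gt0//.
have -> : Num.conj (K^-1)%:C = (K^-1)%:C :> R[i].
  by apply/CrealP; rewrite complex_real.
have -> : complex.Re ((K^-1)%:C * dot (T u) (T u)) = K^-1 * rnorm (T u) ^+ 2.
  by rewrite (dotE norm_dot) -rmorphM.
move=> h.
have h2 : rnorm (T u) ^+ 2 <= (K * rnorm u) ^+ 2.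
  have : K * (4 * (K^-1 * rnorm (T u) ^+ 2)) <=
     K * (K * (2 * rnorm u ^+ 2 + 2 * (K^-1 * rnorm (T u)) ^+ 2)).
    by rewrite ler_wpM2l// ltW.
  have -> : K * (4 * (K^-1 * rnorm (T u) ^+ 2)) = 4 * rnorm (T u) ^+ 2 by field; lra.
  have -> : K * (K * (2 * rnorm u ^+ 2 + 2 * (K^-1 * rnorm (T u)) ^+ 2)) =
    2 * (K * rnorm u) ^+ 2 + 2 * rnorm (T u) ^+ 2 by field; lra.
  lra.
by move: h2; rewrite ler_sqr// nnegrE ?mulr_ge0 ?rnorm_ge0// ltW.
Qed.

Lemma half_pow_cvg : (2^-1 ^+ n : R) @[n --> \oo] --> (0 : R).
Proof. by apply: cvg_expr; rewrite ger0_norm//; lra. Qed.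

Lemma fc_dist g h S T K : 0 < K -> bmf g -> bmf h ->
  (forall t, `|g t - h t| <= K) ->
  is_fc g S -> is_fc h T -> forall u, rnorm (S u - T u) <= K * rnorm u.
Proof.
move=> K0 bg bh ghK fS fT u.
have := fc_comb (-1) _ _ _ _ bh bg fT fS.
have -> : (fun t => -1 * h t + g t) = (fun t => g t - h t).
  by apply/funext => t; ring.
have -> : (fun v => (-1)%:C *: T v + S v) = (fun v => S v - T v).
  by apply/funext => v; rewrite rmorphN1 scaleN1r addrC.
move=> /(fc_bound _ _ K K0); apply => //.
by have [] := bmfB _ _ bg bh.
Qed.

Lemma fc_scale a g T : bmf g -> is_fc g T -> is_fc (fun t => a * g t) (fun u => a%:C *: T u).
Proof.
move=> bg fT; have := fc_comb a _ _ _ _ bg (bmf_indic _ measurable0) fT (fc_indic _ measurable0).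
have -> : (fun t => a * g t + \1_set0 t) = (fun t => a * g t).
  by apply/funext => t; rewrite indic0 addr0.
have -> // : (fun u => a%:C *: T u + E set0 u) = (fun u => a%:C *: T u).
by apply/funext => u; rewrite (pvm_set0 pE) addr0.
Qed.

Lemma fc_form_dist g h u K : bmf g -> bmf h -> (forall t, `|g t - h t| <= K) ->
  `|fc_form g u - fc_form h u| <= K * rnorm u ^+ 2.
Proof.
move=> bg bh ghK.
have -> : fc_form g u - fc_form h u = fc_form (fun t => -1 * h t + g t) u by rewrite fc_form_comb//; ring.
apply: fc_form_bound; first by have [] := bmf_comb (-1) _ _ bh bg.
by move=> t; rewrite mulN1r addrC.
Qed.

(** By [fc_dist] the vectors [S n u] are Cauchy with rate 2^-n; linearity, commutation with [E] and
    the quadratic form all pass to the limit. *)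
Lemma fc_limit g (s : nat -> measurableTypeR R -> R) (S : nat -> H -> H) :
  bmf g -> (forall n, bmf (s n)) -> (forall n, is_fc (s n) (S n)) ->
  (forall n t, `|g t - s n t| <= 2^-1 ^+ n) -> exists T, is_fc g T.
Proof.
move=> bg bs fS gs.
have pos n : 0 < 2^-1 ^+ n :> R by rewrite exprn_gt0.
have dS n m u : rnorm (S n u - S m u) <= (2^-1 ^+ n + 2^-1 ^+ m) * rnorm u.
  apply: (fc_dist (s n) (s m)) => // t.
  have -> : s n t - s m t = - (g t - s n t) + (g t - s m t) by ring.
  by rewrite (le_trans (ler_normD _ _))// normrN lerD.
have cS u : cvg (S n u @[n --> \oo]).
  apply/cauchy_cvgP/cauchy_exP => e e0.
  have eE : e = (complex.Re e)%:C by rewrite RRe_real// gtr0_real.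
  have e0' : 0 < complex.Re e by rewrite -ltcR -eE.
  have : (2^-1 ^+ n * (2 * rnorm u) : R) @[n --> \oo] --> (0 * (2 * rnorm u) : R).
    by apply: cvgM; [exact: half_pow_cvg|exact: cvg_cst].
  rewrite mul0r => /cvgr0Pnorm_lt /(_ _ e0')[N _ NP].
  exists (S N u); exists N => // n /= Nn.
  rewrite -ball_normE /= eE normE ltcR.
  apply: (le_lt_trans (dS _ _ _)); apply: le_lt_trans (NP N (leqnn N)) => /=.
  rewrite ger0_norm ?mulr_ge0 ?rnorm_ge0 ?exprn_ge0//.
  have -> : 2^-1 ^+ N * (2 * rnorm u) = (2^-1 ^+ N + 2^-1 ^+ N) * rnorm u by ring.
  by rewrite ler_wpM2r ?rnorm_ge0// lerD2l; apply: ler_wiXn2l => //; lra.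
pose T u := lim (S n u @[n --> \oo]).
have ST u : S n u @[n --> \oo] --> T u by exact: cS.
have lT : linear T.
  move=> a u v; apply/esym.
  have h : S n (a *: u + v) @[n --> \oo] --> a *: T u + T v.
    have -> : (fun n => S n (a *: u + v)) = (fun n => a *: S n u + S n v).
      by apply/funext => n; have [-> _ _ _] := fS n.
    by apply: cvgD => //; apply: cvgZ => //; exact: cvg_cst.
  exact: (cvg_unique (@norm_hausdorff _ H) h (ST _)).
have dT n u : rnorm (T u - S n u) <= 2^-1 ^+ n * rnorm u.
  have h : (rnorm (S m u - S n u) : R) @[m --> \oo] --> rnorm (T u - S n u).
    apply/cvgrPdist_lt => e e0.
    move: (@cvg_epsE _ _ _ (@eventually_filter) _ _ _ (ST u) e e0).
    apply: filterS => m; apply: le_lt_trans.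
    have h1 := rnorm_dist _ (T u) (S m u) (S n u).
    have h2 := rnorm_dist _ (S m u) (T u) (S n u).
    rewrite (rdistC _ (T u) (S m u)) in h1.
    by rewrite ler_norml; apply/andP; split; lra.
  have h2 : ((2^-1 ^+ m + 2^-1 ^+ n) * rnorm u : R) @[m --> \oo] -->
     ((0 + 2^-1 ^+ n) * rnorm u : R).
    apply: cvgM; last exact: cvg_cst.
    by apply: cvgD; [exact: half_pow_cvg|exact: cvg_cst].
  rewrite add0r in h2.
  by apply: (ler_cvg_to h h2); exact: nearW.
exists T; split=> //.
- have [_ [C C0 SC] _ _] := fS 0%N; exists (C + 1); first lra.
  move=> u; have := dT 0%N u; rewrite expr0 mul1r => h.
  have := rnorm_dist _ (T u) (S 0%N u) 0; rewrite !subr0 => h2.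
  by have := SC u; rewrite mulrDl mul1r; lra.
- move=> D mD u.
  have h : E D (S n u) @[n --> \oo] --> E D (T u).
    exact: (@lip_cvg _ _ (E D) (pvm_linear pE _ mD) _ _ _ _ _ (pvm_lip norm_dot pE _ mD) (ST u)).
  have h' : E D (S n u) @[n --> \oo] --> T (E D u).
    have -> // : (fun n => E D (S n u)) = (fun n => S n (E D u)).
    by apply/funext => n; have [_ _ c _] := fS n; exact: (c D mD u).
  exact: (cvg_unique (@norm_hausdorff _ H) h h').
- move=> u; apply/eqP; rewrite -subr_eq0; apply/eqP; apply: cabs_eq0.
  apply: (le_eps_eq0 _ (2 * rnorm u ^+ 2)); first exact: cabs_ge0.
  move=> n.
  have -> : dot (T u) u - (fc_form g u)%:C =
     dot (T u - S n u) u + (fc_form (s n) u - fc_form g u)%:C.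
    by have [_ _ _ qS] := fS n; rewrite dotBl qS rmorphB /=; ring.
  apply: (le_trans (cabsD _ _)).
  have -> : 2^-1 ^+ n * (2 * rnorm u ^+ 2) =
     2^-1 ^+ n * rnorm u * rnorm u + 2^-1 ^+ n * rnorm u ^+ 2 by ring.
  apply: lerD; last by rewrite cabs_real distrC fc_form_dist.
  by rewrite (le_trans (cauchy_schwarz norm_dot _ _))// ler_wpM2r ?rnorm_ge0.
Qed.

(* Compatibility with every g is part of the induction predicate so that
   multiplicativity passes from indicators to their combinations. *)
Definition simple_fc s := bmf s /\ exists S, is_fc s S /\
  forall g T, bmf g -> is_fc g T -> forall u,
    dot (T (S u)) u = (fc_form (fun t => g t * s t) u)%:C.

Lemma simple_fc_indic D : measurable D -> simple_fc \1_D.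
Proof.
move=> mD; split; first exact: bmf_indic.
exists (E D); split; first exact: fc_indic.
move=> g T bg [lT bT cT qT] u.
rewrite -(pvm_idem pE)// -cT// (pvm_adjoint pE)// qT; congr (fine _)%:C.
rewrite specm_restr//; last by apply/measurable_EFinP; case: bg.
rewrite [LHS]integral_mkcond; congr (integral _ _ _); apply/funext => t.
by rewrite patchE indicE; case: ifP => _; rewrite ?mulr1 ?mulr0.
Qed.

Lemma simple_fc_comb a f h : simple_fc f -> simple_fc h -> simple_fc (fun t => a * f t + h t).
Proof.
move=> [bf [S [fS mS]]] [bh [T [fT mT]]]; split; first exact: bmf_comb.
exists (fun u => a%:C *: S u + T u); split; first exact: fc_comb.
move=> g U bg fU u; have [lU _ _ _] := fU.
rewrite (opD _ lU) (opZ _ lU) dotDl dotZl (mS g)// (mT g)// -rmorphM -rmorphD; congr (_%:C).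
rewrite -fc_form_comb//; [|exact: bmfM|exact: bmfM].
by congr (fc_form _ u); apply/funext => t; ring.
Qed.

(** The affine map with c = 1/(2K) and b = 1/2 sends [-K, K] into [0, 1], the range required by
    [simple_approx]. *)
Lemma fc_approx g : bmf g -> exists2 c : R, 0 < c &
  exists b : R, exists (s : nat -> measurableTypeR R -> R),
  (forall n, simple_fc (s n)) /\ (forall n t, `|(c * g t + b) - s n t| <= 2^-1 ^+ n).
Proof.
move=> [mg [K K0 gK]].
exists (2 * K)^-1; first by rewrite invr_gt0 mulr_gt0.
exists 2^-1.
have : forall n, exists s, simple_fc s /\ forall t, `|((2 * K)^-1 * g t + 2^-1) - s t| <= 2^-1 ^+ n.
  move=> n; have [||t|s] := @simple_approx _ simple_fc (fun t => (2 * K)^-1 * g t + 2^-1)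
    simple_fc_indic _ _ _ n.
  - exact: simple_fc_comb.
  - by apply: measurable_funD => //; apply: measurable_funM.
  - have := gK t; rewrite ler_norml => /andP[g1 g2].
    have -> : (2 * K)^-1 * g t + 2^-1 = (2 * K)^-1 * (g t + K) by field; lra.
    rewrite mulr_ge0 ?invr_ge0/=; [|lra|lra].
    by rewrite ler_pdivrMl; lra.
  - by exists s.
by move=> /choice[s hs]; exists s; split=> n; have [] := hs n.
Qed.

Lemma fc_exists g : bmf g -> exists T, is_fc g T.
Proof.
move=> bg; have [c c0 [b [s [ss gs]]]] := fc_approx _ bg.
have : forall n, exists S, is_fc (s n) S.
  by move=> n; have [_ [S [fS _]]] := ss n; exists S.
move=> /choice[S fS].
have bcb : bmf (fun t => c * g t + b) by apply: bmf_comb => //; exact: bmf_cst.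
have [T fT] := fc_limit _ s S bcb (fun n => (ss n).1) fS gs.
have b1 : bmf (fun t => - (b / c) * \1_setT t) .
  have := bmf_comb (- (b / c)) _ _ (bmf_indic _ measurableT) (bmf_cst 0).
  by congr bmf; apply/funext => t; rewrite addr0.
have f1 := fc_scale (- (b / c)) _ _ (bmf_indic _ measurableT) (fc_indic _ measurableT).
(* The affine change is undone by g = c^-1 (c g + b) - b/c, with [E setT] as the identity
   operator. *)
exists (fun u => c^-1%:C *: T u + (- (b / c))%:C *: E setT u).
have := fc_comb c^-1 _ _ _ _ bcb b1 fT f1.
congr is_fc; apply/funext => t; rewrite indicT /=; field; lra.
Qed.

Definition fc g : H -> H := get [set T | is_fc g T].

Lemma fcP g : bmf g -> is_fc g (fc g).
Proof. by move=> /fc_exists[T fT]; exact: (getPex (ex_intro _ T fT)). Qed.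

Lemma fcE g T : is_fc g T -> fc g = T.
Proof.
move=> fT; have : is_fc g (fc g) by exact: (getPex (ex_intro _ T fT)).
by move=> h; exact: fc_uniq h fT.
Qed.

Lemma fc_id : is_fc (fun=> 1) id.
Proof.
have := fc_indic _ measurableT; rewrite indicT.
by have -> : E setT = id by apply/funext => u; rewrite (pvm_setT pE).
Qed.

(** Only [h] is approximated: against a simple function the product formula is known for every [g],
    and each of the two errors is at most K 2^-n |u|^2. *)
Lemma is_fcM g h S T : bmf g -> bmf h -> is_fc g S -> is_fc h T ->
  is_fc (fun t => g t * h t) (S \o T).
Proof.
move=> bg bh fS fT; have [lS bS cS qS] := fS; have [lT bT cT qT] := fT.
split; [exact: linear_comp|exact: lip_comp|by move=> D mD u /=; rewrite cS// cT|].
move=> u /=; have [c c0 [b [s [ss gs]]]] := fc_approx _ bh.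
have [K K0 gK] := bg.2.
have bc : bmf (fun t => c * h t + b) by apply: bmf_comb => //; exact: bmf_cst.
have f' : is_fc (fun t => c * h t + b) (fun v => c%:C *: T v + b%:C *: v).
  apply: fc_comb => //; first exact: bmf_cst.
  have := fc_scale b _ _ (bmf_cst 1) fc_id.
  by congr is_fc; apply/funext => t; rewrite mulr1.
have key : dot (S (c%:C *: T u + b%:C *: u)) u = (fc_form (fun t => g t * (c * h t + b)) u)%:C.
  apply/eqP; rewrite -subr_eq0; apply/eqP; apply: cabs_eq0.
  apply: (le_eps_eq0 _ (2 * K * rnorm u ^+ 2)) => [|n]; first exact: cabs_ge0.
  have [bs [Sn [fSn mSn]]] := ss n.
  have e0 : 0 < 2^-1 ^+ n :> R by rewrite exprn_gt0.
  have -> : dot (S (c%:C *: T u + b%:C *: u)) u - (fc_form (fun t => g t * (c * h t + b)) u)%:C =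
     dot (S (c%:C *: T u + b%:C *: u - Sn u)) u +
     (fc_form (fun t => g t * s n t) u - fc_form (fun t => g t * (c * h t + b)) u)%:C.
    by rewrite (opB _ lS) dotBl (mSn g)// rmorphB /=; ring.
  apply: (le_trans (cabsD _ _)).
  have -> : 2^-1 ^+ n * (2 * K * rnorm u ^+ 2) =
     (K * (2^-1 ^+ n * rnorm u)) * rnorm u + K * 2^-1 ^+ n * rnorm u ^+ 2 by ring.
  apply: lerD.
    rewrite (le_trans (cauchy_schwarz norm_dot _ _))// ler_wpM2r ?rnorm_ge0//.
    rewrite (le_trans (fc_bound _ _ K K0 bg.1 gK fS _))// ler_wpM2l ?(ltW K0)//.
    exact: (fc_dist _ _ _ _ _ e0 bc bs (gs n) f' fSn u).
  rewrite cabs_real fc_form_dist//; [exact: bmfM|exact: bmfM|].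
  by move=> t; rewrite -mulrBr normrM ler_pM// distrC.
have e1 : fc_form (fun t => g t * (c * h t + b)) u =
    c * fc_form (fun t => g t * h t) u + b * fc_form g u.
  have -> : (fun t => g t * (c * h t + b)) = (fun t => c * (g t * h t) + (b * g t + 0)).
    by apply/funext => t; ring.
  rewrite fc_form_comb//; [|exact: bmfM|apply: bmf_comb => //; exact: bmf_cst].
  by rewrite fc_form_comb//; [rewrite /fc_form Rintegral_cst// mul0r addr0|exact: bmf_cst].
move: key; rewrite (opD _ lS) !(opZ _ lS) dotDl !dotZl qS e1 rmorphD !rmorphM /=.
move=> /addIr; apply: mulfI.
by rewrite eq_complex /= eqxx andbT gt_eqF.
Qed.

Lemma fcM g h u : bmf g -> bmf h -> fc (fun t => g t * h t) u = fc g (fc h u).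
Proof. by move=> bg bh; rewrite (fcE _ _ (is_fcM _ _ _ _ bg bh (fcP _ bg) (fcP _ bh))). Qed.

Lemma fcD g h u : bmf g -> bmf h -> fc (fun t => g t + h t) u = fc g u + fc h u.
Proof.
move=> bg bh; have := fc_comb 1 _ _ _ _ bg bh (fcP _ bg) (fcP _ bh).
have -> : (fun t => 1 * g t + h t) = (fun t => g t + h t) by apply/funext => t; ring.
by move=> /fcE ->; rewrite scale1r.
Qed.

Lemma fc1 u : fc (fun=> 1) u = u.
Proof. by rewrite (fcE _ _ fc_id). Qed.

Lemma fc_pvm D u : measurable D -> fc \1_D u = E D u.
Proof. by move=> mD; rewrite (fcE _ _ (fc_indic _ mD)). Qed.

Lemma fc_linear g : bmf g -> linear (fc g).
Proof. by move=> /fcP[]. Qed.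

Lemma fc_lip g : bmf g -> lip (fc g).
Proof. by move=> /fcP[]. Qed.

Lemma fc_dot g u v : bmf g -> dot (fc g u) v = dot u (fc g v).
Proof. by move=> /fcP/fc_sym. Qed.

Lemma fc_norm g u : bmf g -> rnorm (fc g u) ^+ 2 = fc_form (fun t => g t ^+ 2) u.
Proof.
move=> bg; rewrite -(Re_dot norm_dot) fc_dot// -fcM// dotC.
have [_ _ _ ->] := fcP _ (bmfM _ _ bg bg).
rewrite (_ : Num.conj _ = (fc_form (fun t => g t * g t) u)%:C) //.
by apply/CrealP; rewrite complex_real.
Qed.

Lemma fc_fun_calculus g : bmf g -> fun_calculus dot E g = fc g.
Proof.
move=> bg; have [lT bT _ qT] := fcP _ bg.
have fg u : (fine (spectral_integral dot E g u))%:C = (fc_form g u)%:C :> R[i].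
  by rewrite (spectral_integralE norm_dot pE).
have ex : exists T : H -> H, bounded_operator T /\
    forall u, dot (T u) u = (fine (spectral_integral dot E g u))%:C.
  by exists (fc g); split; [exact/lip_bounded_operator|move=> u; rewrite fg].
have [[lU _] qU] := getPex ex; apply: (op_eq norm_dot) => // u.
by rewrite /fun_calculus qU qT fg.
Qed.

Definition window (n : nat) : set (measurableTypeR R) := [set t | `|t| <= n%:R].

Lemma measurable_window n : measurable (window n).
Proof.
have -> : window n = `[- n%:R, n%:R]%classic.
  by apply/seteqP; split=> t /=; rewrite /window /= in_itv/= ler_norml.
exact: measurable_itv.
Qed.

Lemma windowS m n : (m <= n)%N -> window m `<=` window n.
Proof. by move=> mn t /le_trans; apply; rewrite ler_nat. Qed.

(** The squared distance from [u] to its projection is the difference of the squared norms, which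
    tends to 0 by continuity from below of the spectral measure. *)
Lemma pvm_window_cvg u : E (window n) u @[n --> \oo] --> u.
Proof.
have h : (mu u (window n) @[n --> \oo] --> mu u (\bigcup_n window n))%E.
  apply: nondecreasing_cvg_mu.
  - by move=> n; exact: measurable_window.
  - by apply: bigcup_measurable => n _; exact: measurable_window.
  - by move=> m n mn; apply/subsetPset; exact: windowS.
have UT : \bigcup_n window n = setT.
  apply/seteqP; split=> // t _; exists (Num.truncn `|t|).+1 => //=.
  by rewrite /window /= ltW// truncnS_gt.
rewrite UT specmT in h.
have h2 : (rnorm (E (window n) u) ^+ 2 : R) @[n --> \oo] --> (rnorm u ^+ 2 : R).
  move/fine_cvg : h; apply: cvg_trans; apply: near_eq_cvg; apply: nearW => n /=.
  by rewrite specmE//; exact: measurable_window.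
have h3 : (rnorm u ^+ 2 - rnorm (E (window n) u) ^+ 2 : R) @[n --> \oo] -->
    (rnorm u ^+ 2 - rnorm u ^+ 2 : R).
  by apply: cvgB => //; exact: cvg_cst.
rewrite subrr in h3.
apply: cvg_eps => e e0; move/cvgr0Pnorm_lt : h3 => /(_ _ (exprn_gt0 2 e0)).
apply: filterS => n.
have -> : rnorm u ^+ 2 - rnorm (E (window n) u) ^+ 2 = rnorm (E (window n) u - u) ^+ 2.
  have mn := measurable_window n.
  rewrite -!(Re_dot norm_dot) !(dotBl, dotBr) -ReB; congr complex.Re.
  rewrite (_ : dot u (E (window n) u) = dot (E (window n) u) u).
    by rewrite [dot (E _ _) u](pvm_dot pE)//; ring.
  by rewrite -(pvm_adjoint pE).
rewrite ger0_norm ?sqr_ge0// ltr_pXn2r ?nnegrE ?rnorm_ge0//; exact: ltW.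
Qed.

End FunctionalCalculus.

(** * The particular functions of [A] that occur *)

Section Functions.
Context {R : realType}.
Implicit Types t : measurableTypeR R.

(* qf(A) = (A^2 + 1)^(-1/2) will identify H_{-2} with H, and then
   A (A^2 + 1)^-1 = ef(A) qf(A). *)
Definition qf t : R := (Num.sqrt (t ^+ 2 + 1))^-1.
Definition ef t : R := t * qf t.
Definition af n t : R := t * \1_(window n) t.

Let s0 t : 0 < Num.sqrt (t ^+ 2 + 1) :> R.
Proof. by rewrite sqrtr_gt0 ltr_wpDl// sqr_ge0. Qed.

Let s1 t : 1 <= Num.sqrt (t ^+ 2 + 1) :> R.
Proof. by rewrite -[leLHS]sqrtr1 ler_wsqrtr// lerDr sqr_ge0. Qed.

Lemma qf_gt0 t : 0 < qf t. Proof. by rewrite invr_gt0. Qed.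

Lemma qf_sqr t : (t ^+ 2 + 1) * qf t ^+ 2 = 1.
Proof.
rewrite /qf exprVn sqr_sqrtr ?mulfV//; last by rewrite ltW// ltr_wpDl// sqr_ge0.
by rewrite gt_eqF// ltr_wpDl// sqr_ge0.
Qed.

Lemma measurable_qf : measurable_fun setT qf.
Proof.
apply: continuous_measurable_fun => x; apply: cvgV; first by rewrite gt_eqF.
apply: (@continuous_comp _ _ _ (fun t : R => t ^+ 2 + 1) Num.sqrt); last exact: sqrt_continuous.
by apply: cvgD; [exact: exprn_continuous|exact: cvg_cst].
Qed.

Lemma bmf_qf : bmf qf.
Proof.
split; first exact: measurable_qf.
by exists 1 => // t; rewrite ger0_norm ?(ltW (qf_gt0 t))// invf_le1.
Qed.

Lemma measurable_idR : measurable_fun setT (fun t => t : R).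
Proof. exact: measurable_id. Qed.

Lemma ef_le1 t : `|ef t| <= 1.
Proof.
rewrite -(@ler_pXn2r _ 2)// ?nnegrE// real_normK ?num_real// expr1n -(qf_sqr t).
by rewrite /ef exprMn mulrDl lerDl mul1r sqr_ge0.
Qed.

Lemma bmf_ef : bmf ef.
Proof.
split; first by apply: measurable_funM; [exact: measurable_idR|exact: measurable_qf].
by exists 1 => // t; exact: ef_le1.
Qed.

Lemma af_le n t : `|af n t| <= n%:R.
Proof.
rewrite /af indicE; case: (boolP (t \in window n)); rewrite ?inE => h.
  by rewrite mulr1.
by rewrite mulr0 normr0 ler0n.
Qed.

Lemma bmf_af n : bmf (af n).
Proof.
split.
  apply: measurable_funM; first exact: measurable_idR.
  by apply: measurable_indic; exact: measurable_window.
by exists n.+1%:R => // t; rewrite (le_trans (af_le _ _))// ler_nat.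
Qed.

Lemma bmf_window n : bmf \1_(@window R n).
Proof. by apply: bmf_indic; exact: measurable_window. Qed.

(** These three come from the definitions of the theorem: [rf] gives the norm of H_{-2}, while [zf]
    and [tf] are applied to [w2] in the perturbed operator. *)
Definition rf t : R := (`|t| + 1)^-1.
Definition zf t : R := (t ^+ 2 + 1)^-1.
Definition tf t : R := t / (t ^+ 2 + 1).

Lemma zfE : zf = fun t => qf t * qf t.
Proof.
apply/funext => t; rewrite /zf /qf -invfM -expr2 sqr_sqrtr//.
by rewrite ltW// ltr_wpDl// sqr_ge0.
Qed.

Lemma tfE : tf = fun t => ef t * qf t.
Proof. by apply/funext => t; rewrite /tf -/(zf t) zfE /ef mulrA. Qed.

Lemma rf_gt0 t : 0 < rf t.
Proof. by rewrite invr_gt0 ltr_wpDl. Qed.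

Lemma bmf_rf : bmf rf.
Proof.
split.
  apply: continuous_measurable_fun => x; apply: cvgV; first by rewrite gt_eqF// ltr_wpDl.
  by apply: cvgD; [exact: norm_continuous|exact: cvg_cst].
by exists 1 => // t; rewrite ger0_norm ?(ltW (rf_gt0 t))// invf_le1 ?ltr_wpDl// lerDr.
Qed.

Lemma rf_le_qf t : rf t ^+ 2 <= qf t ^+ 2.
Proof.
have -> : qf t ^+ 2 = zf t by rewrite zfE expr2.
rewrite /rf exprVn lef_pV2 ?posrE ?exprn_gt0 ?ltr_wpDl ?sqr_ge0//.
rewrite sqrrD -normrX ger0_norm ?sqr_ge0// mulr1 expr1n lerD2r lerDl.
by rewrite mulrn_wge0.
Qed.

(** This is (|t| + 1)^2 <= 2 (t^2 + 1), that is (|t| - 1)^2 >= 0. Together with [rf_le_qf] it lets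
    (A^2 + 1)^(-1/2) replace (|A| + 1)^-1 in the norm of H_{-2}. *)
Lemma qf_le_rf t : qf t ^+ 2 <= 2 * rf t ^+ 2.
Proof.
have -> : qf t ^+ 2 = zf t by rewrite zfE expr2.
have t0 : 0 < t ^+ 2 + 1 by rewrite ltr_wpDl ?sqr_ge0.
have n0 : 0 < `|t| + 1 by rewrite ltr_wpDl.
rewrite /rf /zf exprVn -ler_pdivrMr ?invr_gt0 ?exprn_gt0// invrK.
rewrite ler_pdivrMl// -[t ^+ 2]real_normK ?num_real//.
have := sqr_ge0 (`|t| - 1); rewrite !sqrrD; lra.
Qed.

End Functions.

(** * Splitting an infinite integral into two infinite ones *)

Section SplitInfinite.
Context {R : realType} (m : {measure set (measurableTypeR R) -> \bar R}).
Context (h : measurableTypeR R -> \bar R).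
Context (mh : measurable_fun setT h) (h0 : forall t, (0 <= h t)%E).
Context (hfin : forall n, (\int[m]_(t in window n) h t < +oo)%E).
Context (hinf : (\int[m]_t h t = +oo)%E).
Local Open Scope ereal_scope.

(** Since the window carries finite mass, its complement carries infinite mass, and monotone
    convergence over larger windows passes 1. *)
Let tail N : exists M, (N <= M)%N /\ 1 <= \int[m]_(t in window M `\` window N) h t.
Proof.
have mc n := @measurable_window R n.
have tinf : \int[m]_(t in ~` window N) h t = +oo.
  move: hinf; rewrite -(setUv (window N)) ge0_integral_setU//; last 3 first.
  - exact: measurableC.
  - by rewrite setUv.
  - by apply/disj_setPS => t [].
  have := hfin N; have := @integral_ge0 _ _ _ m (window N) h (fun t _ => h0 t).
  by case: (\int[m]_(t in window N) h t) => //; case: (\int[m]_(t in ~` window N) h t).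
have UC : (\bigcup_M (window M `\` window N) = ~` (@window R N))%classic.
  rewrite eqEsubset; split=> [t [M _ []]//|t Nt].
  exists (Num.truncn `|t|).+1 => //; split=> //.
  by rewrite /window /= ltW// truncnS_gt.
have : \int[m]_(t in window M `\` window N) h t @[M --> \oo] -->
    \int[m]_(t in \bigcup_M (window M `\` window N)) h t.
  apply: ge0_nondecreasing_set_cvg_integral => //.
  - by move=> i j ij; apply/subsetPset; apply: setSD; exact: windowS.
  - by move=> i; exact: measurableD.
  - by move=> i; exact: measurable_funTS.
rewrite UC tinf => /cvgeyPge /(_ 1%R)[M _ hM].
exists (maxn N M); split; first exact: leq_maxl.
by apply: hM => /=; exact: leq_maxr.
Qed.

(* Cut the line into shells between windows, each of mass at least one; the even
   shells form S and the odd ones lie in its complement. *)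
Lemma split_infinite : exists S, [/\ measurable S, \int[m]_(t in S) h t = +oo &
  \int[m]_(t in ~` S) h t = +oo].
Proof.
have mc n := @measurable_window R n.
have [M MP] := choice tail.
pose N k := iter k M 0%N; pose C k := window (N k.+1) `\` @window R (N k).
have mC k : measurable (C k) by exact: measurableD.
have Nmono i j : (i <= j)%N -> (N i <= N j)%N.
  elim: j => [|j IH]; first by rewrite leqn0 => /eqP ->.
  by rewrite leq_eqVlt => /predU1P[->//|/IH h1]; apply: (leq_trans h1); have [] := MP (N j).
have disjC i j : (i < j)%N -> C i `&` C j = set0.
  move=> ij; rewrite -subset0 => t [[ti _] [_ tj]]; apply: tj.
  exact: (windowS _ _ (Nmono _ _ ij)).
have triv (f : nat -> nat) : (forall i j, (i < j)%N -> (f i < f j)%N) -> trivIset setT (C \o f).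
  move=> fm; apply: ltn_trivIset => i j ji. apply: disjC; exact: fm.
(* Any increasing choice of shells has infinite mass: each has mass at least one, so the first
   [truncn |x| + 1] of them already exceed [x]. *)
have inf (f : nat -> nat) : (forall i j, (i < j)%N -> (f i < f j)%N) ->
    \int[m]_(t in \bigcup_k C (f k)) h t = +oo.
  move=> fm; have := @ge0_integral_bigcup _ _ _ m (C \o f) h (fun k => mC (f k))
    (measurable_funTS mh) (fun t _ => h0 t) (triv f fm).
  rewrite /= => ->.
  apply: eq_infty => x.
  have pos k : 0 <= \int[m]_(t in (C \o f) k) h t by exact: integral_ge0.
  apply: (@le_trans _ _ (\sum_(0 <= k < (Num.truncn `|x|).+1) \int[m]_(t in (C \o f) k) h t)).
    apply: (@le_trans _ _ (\sum_(0 <= k < (Num.truncn `|x|).+1) 1)).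
      rewrite big_mkord sumEFin lee_fin sumr_const card_ord.
      by rewrite (le_trans (ler_norm x))// ltW// truncnS_gt.
    by apply: lee_sum => k _; exact: (MP _).2.
  by apply: nneseries_lim_ge => k _ _.
exists (\bigcup_k C k.*2); split.
- by apply: bigcup_measurable.
- by apply: inf => i j; rewrite ltn_double.
- apply/eqP; rewrite -leye_eq -(inf (fun k => k.*2.+1)); last first.
    by move=> i j; rewrite ltnS ltn_double.
  apply: ge0_subset_integral => //.
  + exact: bigcup_measurable.
  + by apply: measurableC; exact: bigcup_measurable.
  + exact: measurable_funTS.
  (* An odd and an even index never coincide, and shells of different index are disjoint. *)
  + move=> t [k _ Ck] [l _ Cl].
    have [kl|lk|kl] := ltngtP k.*2.+1 l.*2.
    * by have : (C k.*2.+1 `&` C l.*2) t by []; rewrite disjC.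
    * by have : (C l.*2 `&` C k.*2.+1) t by []; rewrite disjC.
    * by have := congr1 odd kl; rewrite /= !odd_double.
Qed.

End SplitInfinite.

(** * The operator [A] in terms of its spectral measure *)

Section SelfAdjoint.
Context {R : realType} {H : completeNormedModType R[i]} {dot : {dot H for Num.conj}}.
Context (norm_dot : forall u : H, `|u| ^+ 2 = dot u u).
Context {A : set (H * H)} (saA : self_adjoint dot A).
Context {E : set (measurableTypeR R) -> H -> H} (EA : spectral_measure_of dot A E).
Implicit Types (u v w y : H) (D S : set (measurableTypeR R)).

Local Notation pE := (sm_pvm EA).
Local Notation mu := (specm norm_dot pE).
Local Notation fc := (fc norm_dot pE).
Local Notation Q := (fc_form norm_dot pE).
Local Notation mW := (@measurable_window R).

(** [A] equals its adjoint, whose defining condition is preserved by linear combinations of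
    pairs. *)
Lemma graph_linear a u y v y' : A (u, y) -> A (v, y') -> A (a *: u + v, a *: y + y').
Proof.
have [_ AE] := saA; rewrite AE => /= h1 h2 p Ap /=.
by rewrite !dotDr !dotZr (h1 p Ap) (h2 p Ap).
Qed.

Lemma graph0 : A (0, 0).
Proof. by have [_ ->] := saA; move=> p Ap /=; rewrite !dot0r. Qed.

Lemma domain_comb a u v : domain A u -> domain A v -> domain A (a *: u + v).
Proof. by move=> [y uy] [y' vy]; exists (a *: y + y'); exact: graph_linear. Qed.

Lemma domain_pvm S u : measurable S ->
  domain A (E S u) <-> (\int[mu u]_(t in S) (t ^+ 2)%:E < +oo)%E.
Proof.
move=> mS; rewrite (sm_domain EA) (spectral_integralE norm_dot pE) specm_restr//.
apply/measurable_EFinP; exact: measurable_funX.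
Qed.

Lemma integral_window_sqr n u :
  (\int[mu u]_(t in window n) (t ^+ 2)%:E = (rnorm (fc (af n) u) ^+ 2)%:E)%E.
Proof.
have baf := @bmf_af R n; have bsq := bmfM _ _ baf baf.
rewrite (fc_norm norm_dot pE)// /Q /Rintegral fineK; last first.
  have := integrable_fin_num measurableT (bmf_integrable (mu u) _ bsq).
  by congr (_ \is a fin_num); apply: eq_integral => t _ /=; rewrite expr2.
rewrite [LHS]integral_mkcond; congr (integral _ _ _); apply/funext => t.
rewrite patchE /af indicE; case: ifP => _; first by rewrite mulr1.
by rewrite mulr0 expr0n.
Qed.

Lemma bigcup_window : \bigcup_n @window R n = setT.
Proof.
apply/seteqP; split=> // t _; exists (Num.truncn `|t|).+1 => //=.
by rewrite /window /= ltW// truncnS_gt.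
Qed.

Let mt2 D : measurable_fun D (fun t : measurableTypeR R => (t ^+ 2)%:E).
Proof. by apply: measurable_funTS; apply/measurable_EFinP; exact: measurable_funX. Qed.

Let t20 (t : measurableTypeR R) : (0 <= (t ^+ 2)%:E)%E.
Proof. by rewrite lee_fin sqr_ge0. Qed.

(** The squared norms are second moments of [mu u] over the windows, so by monotone convergence a
    uniform bound makes the full second moment finite. *)
Lemma domain_of_bound u K : (forall n, rnorm (fc (af n) u) <= K) -> domain A u.
Proof.
move=> uK; apply/(sm_domain EA); rewrite (spectral_integralE norm_dot pE).
have := @ge0_nondecreasing_set_cvg_integral _ _ _ (@window R) (fun t => (t ^+ 2)%:E) (mu u)
  _ mW (fun n => mt2 _) (fun n t _ => t20 t).
rewrite bigcup_window => h.
apply: (@le_lt_trans _ _ (K ^+ 2)%:E); last exact: ltry.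
apply: (cvge_to_le (h _)) => [m n mn|]; first by apply/subsetPset; exact: windowS.
apply: nearW => n; rewrite integral_window_sqr lee_fin ler_sqr ?nnegrE ?rnorm_ge0//.
by rewrite (le_trans (rnorm_ge0 _ (fc (af n) u))).
Qed.

Lemma domain_window n u : domain A (E (window n) u).
Proof.
apply/domain_pvm; first exact: mW.
by rewrite integral_window_sqr ltry.
Qed.

(** |t| <= t^2 + 1, and [mu u] is finite. *)
Lemma integrable_domain u : domain A u -> (mu u).-integrable setT (EFin \o id).
Proof.
move=> /(sm_domain EA); rewrite (spectral_integralE norm_dot pE) => ufin.
apply/integrableP; split; first by apply/measurable_EFinP; exact: measurable_id.
have m1 : (\int[mu u]_t (t ^+ 2 + 1)%:E < +oo)%E.
  under eq_integral do rewrite EFinD.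
  rewrite ge0_integralD//.
  by rewrite lte_add_pinfty// integral_cst//= mul1e specmT ltry.
apply: le_lt_trans m1; apply: ge0_le_integral => //.
- by apply/measurable_EFinP; exact: normr_measurable.
- by apply/measurable_EFinP; apply: measurable_funD => //; exact: measurable_funX.
move=> t _; rewrite /= lee_fin.
have := sqr_ge0 (`|t| - 1); have := sqr_ge0 t.
rewrite -[t ^+ 2]real_normK ?num_real// sqrrB; lra.
Qed.

(* Polarize the quadratic form of A at u + c E(window) v: its part outside the
   window does not depend on c. *)
Lemma window_graph n u y : A (u, y) -> E (window n) y = fc (af n) u.
Proof.
move=> Auy; pose W := @window R n.
have mWn : measurable W by exact: mW.
have baf := @bmf_af R n; set M := fc (af n).
have lM : linear M by exact: fc_linear.
have EM x : E W (M x) = M x.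
  rewrite -(fc_pvm norm_dot pE)// -(fcM norm_dot pE)//; last exact: bmf_window.
  congr (fc _ x); apply/funext => t; rewrite /af mulrCA indicE.
  by case: (t \in W); rewrite ?mulr1 ?mul1r ?mulr0.
have ME x : M (E W x) = M x.
  by have [_ _ c _] := fcP norm_dot pE _ baf; exact: etrans (esym (c W mWn x)) (EM x).
apply: (dot_ext norm_dot) => v; pose v' := E W v.
have [y' Avy] : domain A v' by exact: domain_window.
pose K := (\int[mu u]_(t in ~` W) t).
have F c : dot (y + c *: y') (u + c *: v') - dot (M (u + c *: v')) (u + c *: v') = K%:C.
  have Aw : A (u + c *: v', y + c *: y').
    by rewrite addrC (addrC y); exact: graph_linear.
  have /integrable_domain iw : domain A (u + c *: v') by exists (y + c *: y').
  rewrite (sm_value EA Aw) (spectral_integralE norm_dot pE).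
  have [_ _ _ ->] := fcP norm_dot pE _ baf.
  rewrite -rmorphB; congr (_%:C).
  rewrite -[fine _]/(\int[mu (u + c *: v')]_t t).
  have -> : \int[mu (u + c *: v')]_t t =
     \int[mu (u + c *: v')]_(t in W) t + \int[mu (u + c *: v')]_(t in ~` W) t.
    rewrite -Rintegral_setU ?setUv//; first exact: measurableC.
    by apply/disj_setPS => t [].
  have -> : Q (af n) (u + c *: v') = \int[mu (u + c *: v')]_(t in W) t.
    rewrite [RHS]Rintegral_mkcond /Q; congr (fine (integral _ _ _)); apply/funext => t.
    by rewrite patchE /af indicE; case: ifP => _; rewrite ?mulr1 ?mulr0.
  rewrite addrAC subrr add0r /K /Rintegral; congr fine.
  apply: specm_agree; first exact: measurableC.
  rewrite (opD _ (pvm_linear pE _ _)) ?(opZ _ (pvm_linear pE _ _)); try exact: measurableC.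
  by rewrite /v' (pvmI pE)//; [rewrite setICl (pvm_set0 pE) scaler0 addr0|exact: measurableC].
pose X := dot y v' - dot (M u) v'; pose Y := dot y' u - dot (M v') u.
have F' c : Num.conj c * X + c * Y + c * Num.conj c * (dot y' v' - dot (M v') v') =
   K%:C - (dot y u - dot (M u) u).
  by rewrite -(F c) (opD _ lM) (opZ _ lM) !(dotDl, dotDr, dotZl, dotZr) /X /Y; ring.
have X0 : X = 0.
  have i2 : 'i%C * 'i%C = -1 :> R[i] by rewrite -expr2 sqr_i.
  have cN1 : Num.conj (-1) = -1 :> R[i] by rewrite rmorphN rmorph1.
  have cNi : Num.conj (- 'i%C) = 'i%C :> R[i] by rewrite rmorphN /= conj_i opprK.
  have e1 := etrans (F' 1) (esym (F' (-1))).
  have e2 := etrans (F' 'i%C) (esym (F' (- 'i%C))).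
  rewrite rmorph1 cN1 in e1; rewrite conj_i cNi in e2.
  move: (dot y' v' - _) e1 e2 => Z e1 e2.
  (* The values 1, -1, i, -i of [c] isolate [X]; the term in |c|^2 cancels within each pair of
     opposite values. *)
  have e3 : 4 * X = 0.
    transitivity (((1 * X + 1 * Y + 1 * 1 * Z) - (-1 * X + -1 * Y + -1 * -1 * Z)) + 'i%C *
      ((- 'i%C * X + 'i%C * Y + 'i%C * - 'i%C * Z) -
      ('i%C * X + - 'i%C * Y + - 'i%C * 'i%C * Z))).
      by ring: i2.
    by rewrite e1 e2 !subrr mulr0 addr0.
  by move/eqP: e3; rewrite mulf_eq0 pnatr_eq0 /= => /eqP.
rewrite -(EM u) !(pvm_adjoint pE)//.
by apply/eqP; rewrite -subr_eq0; apply/eqP.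
Qed.

Lemma bound_of_domain u y n : A (u, y) -> rnorm (fc (af n) u) <= rnorm y.
Proof. by move=> h; rewrite -(window_graph _ _ _ h) (pvm_contract norm_dot pE _ (mW n)). Qed.

(** Formally (A^2 + 1)^-1 (1 + A^2) u = u. As [A] acts as a bounded function only inside windows,
    the identity is checked there and passed to the limit. *)
Lemma graph_repr u y : A (u, y) -> u = fc qf (fc qf u + fc ef y).
Proof.
move=> Auy; have bq := @bmf_qf R; have be := @bmf_ef R.
have lq : linear (fc qf) by exact: fc_linear.
have h n : E (window n) u = E (window n) (fc qf (fc qf u + fc ef y)).
  have bw := @bmf_window R n; have ba := @bmf_af R n.
  rewrite (opD _ lq) -!(fcM norm_dot pE)//.
  have lw := pvm_linear pE _ (mW n); rewrite (opD _ lw).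
  have mn := mW n.
  have [_ _ c _] := fcP norm_dot pE _ (bmfM _ _ bq be).
  rewrite (c _ (mW n)) (window_graph _ _ _ Auy) -!(fc_pvm norm_dot pE)//.
  rewrite -!(fcM norm_dot pE)//; try exact: bmfM.
  rewrite -(fcD norm_dot pE); try by [exact: bmfM|apply: bmfM => //; exact: bmfM].
  congr (fc _ u); apply/funext => t.
  rewrite /af /ef -[LHS]mulr1 -(qf_sqr t); ring.
have h1 := pvm_window_cvg norm_dot pE u.
have h2 := pvm_window_cvg norm_dot pE (fc qf (fc qf u + fc ef y)).
have e : (fun n => E (window n) (fc qf (fc qf u + fc ef y))) = (fun n => E (window n) u).
  by apply/funext => k; rewrite h.
rewrite e in h2.
exact: (cvg_unique (@norm_hausdorff _ H) h1 h2).
Qed.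

Lemma fc_le1 g u : bmf g -> (forall t, `|g t| <= 1) -> rnorm (fc g u) <= rnorm u.
Proof.
move=> bg g1; rewrite -[leRHS]mul1r.
exact: (fc_bound norm_dot pE g _ 1 ltr01 bg.1 g1 (fcP norm_dot pE _ bg)).
Qed.

Lemma domain_qf h : domain A (fc qf h).
Proof.
have bq := @bmf_qf R.
apply: (domain_of_bound _ (rnorm h)) => n.
have ba := @bmf_af R n.
rewrite -(fcM norm_dot pE)//; apply: fc_le1; first exact: bmfM.
move=> t; have -> : af n t * qf t = ef t * \1_(window n) t by rewrite /af /ef; ring.
rewrite normrM indicE; case: (_ \in _); rewrite ?normr1 ?normr0 ?mulr1 ?mulr0 ?ler01//.
exact: ef_le1.
Qed.

Lemma domainP u : domain A u <-> exists h, u = fc qf h.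
Proof.
split=> [[y Auy]|[h ->]]; last exact: domain_qf.
by exists (fc qf u + fc ef y); exact: graph_repr.
Qed.

Lemma unbounded_of_notin u : ~ domain A u ->
  forall K, exists n, K < rnorm (fc (af n) u).
Proof.
move=> nu K; apply: contrapT => h; apply: nu.
apply: (domain_of_bound _ K) => n; rewrite leNgt; apply/negP => Kn.
by apply: h; exists n.
Qed.

(** Outside the domain the second moment of [mu u] is infinite although every window contributes a
    finite part, so [split_infinite] applies with t^2 as integrand. *)
Lemma domain_split u : ~ domain A u -> exists S, [/\ measurable S,
  ~ domain A (E S u) & ~ domain A (E (~` S) u)].
Proof.
move=> nu; have [||n||S [mS S1 S2]] := @split_infinite _ (mu u) (fun t => (t ^+ 2)%:E).
- exact: mt2.
- exact: t20.
- by rewrite integral_window_sqr ltry.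
- apply/eqP; rewrite -leye_eq leNgt; apply/negP => h; apply: nu.
  by apply/(sm_domain EA); rewrite (spectral_integralE norm_dot pE).
- exists S; split=> //; first by move=> /domain_pvm; rewrite S1 => /(_ mS).
  by move=> /domain_pvm; rewrite S2 => /(_ (measurableC mS)).
Qed.

End SelfAdjoint.

(** * The space H_{-2} and its identification with [H] *)

Section Hminus2.
Context {R : realType} {H : completeNormedModType R[i]} {dot : {dot H for Num.conj}}.
Context (norm_dot : forall u : H, `|u| ^+ 2 = dot u u).
Context {A : set (H * H)} (saA : self_adjoint dot A).
Context {E : set (measurableTypeR R) -> H -> H} (EA : spectral_measure_of dot A E).
Context {Hm2 : completeNormedModType R[i]} {iota : {linear H -> Hm2}}.
Context (complHm2 : is_Hminus2 dot iota E).
Implicit Types (f g h u v y : H) (w : Hm2).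

Local Notation pE := (sm_pvm EA).
Local Notation mu := (specm norm_dot pE).
Local Notation fc := (fc norm_dot pE).
Local Notation Q := (fc_form norm_dot pE).

Lemma iota_norm f : rnorm (iota f) = rnorm (fc rf f).
Proof. by rewrite /rnorm complHm2.1 (fc_fun_calculus norm_dot pE _ (@bmf_rf R)). Qed.

Let Q_le (g g' : measurableTypeR R -> R) u : bmf g -> bmf g' ->
  (forall t, g t <= g' t) -> Q g u <= Q g' u.
Proof. by move=> bg bg' gg; apply: le_Rintegral => //; exact: bmf_integrable. Qed.

Let bq := @bmf_qf R.
Let br := @bmf_rf R.
Let lq : linear (fc qf). Proof. exact: fc_linear. Qed.

Let bmf_sq (g : measurableTypeR R -> R) : bmf g -> bmf (fun t => g t ^+ 2).
Proof.
by move=> bg; have := bmfM _ _ bg bg; congr bmf; apply/funext => t; rewrite expr2.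
Qed.

Lemma iota_le_qf f : rnorm (iota f) <= rnorm (fc qf f).
Proof.
rewrite iota_norm -(@ler_pXn2r _ 2)// ?nnegrE ?rnorm_ge0//.
rewrite !(fc_norm norm_dot pE)//; apply: Q_le; [exact: bmf_sq|exact: bmf_sq|].
exact: rf_le_qf.
Qed.

Lemma qf_le_iota f : rnorm (fc qf f) <= 2 * rnorm (iota f).
Proof.
rewrite iota_norm -(@ler_pXn2r _ 2)// ?nnegrE ?mulr_ge0 ?rnorm_ge0//.
rewrite exprMn !(fc_norm norm_dot pE)//.
have -> : 2 ^+ 2 * Q (fun t => rf t ^+ 2) f = Q (fun t => 4 * rf t ^+ 2 + 0) f.
  rewrite (fc_form_comb norm_dot pE 4 _ _ f (bmf_sq _ br) (bmf_cst 0)).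
  by rewrite [X in _ + X](_ : _ = 0) ?addr0; [ring|rewrite /fc_form Rintegral_cst// mul0r].
apply: Q_le; [exact: bmf_sq|apply: bmf_comb; [exact: bmf_sq|exact: bmf_cst]|].
by move=> t; have := qf_le_rf t; have := sqr_ge0 (rf t); lra.
Qed.

Lemma iota_dense w (e : R) : 0 < e -> exists f, rnorm (w - iota f) < e.
Proof.
move=> e0; have e0' : 0 < e%:C by rewrite ltcR.
have [] := complHm2.2 (ball w e%:C) _ (ball_open w _).
  by exists w; exact: ballxx.
by move=> x []; rewrite -ball_normE /= normE ltcR => h [f _ fw]; exists f; rewrite fw.
Qed.

Definition near_iota w : set_system H := filter_from (nbhs w) (fun V => iota @^-1` V).

Lemma near_iotaP w (e : R) : 0 < e -> near_iota w [set f | rnorm (w - iota f) < e].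
Proof.
move=> e0; have e0' : 0 < e%:C by rewrite ltcR.
exists (ball w e%:C); first exact: nbhsx_ballx.
by move=> f /=; rewrite -ball_normE /= normE ltcR.
Qed.

(** Density of the range of [iota] makes the filter proper; limits along it are then unique, which
    determines the [get] in every extension. *)
#[local] Instance near_iota_proper w : ProperFilter (near_iota w).
Proof.
apply: filter_from_proper; last first.
  move=> V /nbhs_ballP[e e0 wV].
  have eE : e = (complex.Re e)%:C by rewrite RRe_real// gtr0_real.
  have e0' : 0 < complex.Re e by rewrite -ltcR -eE.
  have [f fw] := iota_dense w _ e0'.
  by exists f; apply: wV; rewrite -ball_normE /= normE eE ltcR.
apply: filter_from_filter; first by exists setT; exact: filterT.
by move=> V W wV wW; exists (V `&` W) => //; exact: filterI.
Qed.

Lemma extend_get (W : normedModType R[i]) (T : H -> W) w (l : W) :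
  extend iota T w l -> get (extend iota T w) = l.
Proof.
move=> Ty; have Tg : extend iota T w (get (extend iota T w)) by apply: getPex; exists l.
exact: (@cvg_unique _ (@norm_hausdorff _ W) _
  (fmap_proper_filter T (near_iota_proper w)) _ _ Tg Ty).
Qed.

(* The isomorphism of H_{-2} onto H extending (A^2 + 1)^(-1/2). *)
Definition J w : H := ext_fun_calculus dot iota E (fun t => (Num.sqrt (t ^+ 2 + 1))^-1) w.

(** [qf_le_iota] makes the values of [fc qf] Cauchy along [near_iota w], and [H] is complete. *)
Lemma J_extend w : extend iota (fc qf) w (J w).
Proof.
have JE : J w = get (extend iota (fc qf) w).
  by rewrite /J /ext_fun_calculus (fc_fun_calculus norm_dot pE _ bq).
rewrite JE; apply: getPex.
have : cvg (fc qf f @[f --> near_iota w]); last by move=> c; eexists; exact: c.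
apply/cauchy_cvgP/cauchy_exP => e e0.
have eE : e = (complex.Re e)%:C by rewrite RRe_real// gtr0_real.
have e0' : 0 < complex.Re e by rewrite -ltcR -eE.
(* Two distances below a quarter of [e] are added and then doubled by [qf_le_iota]. *)
have e4 : 0 < complex.Re e / 4 by rewrite divr_gt0.
have [f0 f0w] := iota_dense w _ e4.
exists (fc qf f0); apply: filterS (near_iotaP w _ e4) => f /= fw.
rewrite -ball_normE /= eE normE ltcR -(opB _ lq).
apply: (le_lt_trans (qf_le_iota _)); rewrite linearB.
have := rnorm_dist _ (iota f0) w (iota f); rewrite (rdistC _ (iota f0) w); lra.
Qed.

Lemma J_dist w f : rnorm (J w - fc qf f) <= 2 * rnorm (w - iota f).
Proof.
apply/ler_addgt0Pr => e e0; have e3 : 0 < e / 3 by rewrite divr_gt0.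
have h1 := @cvg_epsE _ _ (near_iota w)
  (@filter_filter _ _ (near_iota_proper w)) _ _ _ (J_extend w) _ e3.
have [f' [/= h2 h3]] := filter_ex (filterI h1 (near_iotaP w _ e3)).
have := rnorm_dist _ (J w) (fc qf f') (fc qf f).
rewrite (rdistC _ (J w) (fc qf f')) -(opB _ lq).
have := qf_le_iota (f' - f); rewrite linearB.
have := rnorm_dist _ (iota f') w (iota f); rewrite (rdistC _ (iota f') w); lra.
Qed.

Lemma J_iota f : J (iota f) = fc qf f.
Proof.
apply/eqP; rewrite -subr_eq0; apply/eqP/rnorm_eq0/eqP; rewrite eq_le rnorm_ge0 andbT.
by have := J_dist (iota f) f; rewrite subrr rnorm0 mulr0.
Qed.

Lemma iota_seq w : exists f : nat -> H, iota (f n) @[n --> \oo] --> w.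
Proof.
have : forall n, exists f, rnorm (w - iota f) < n.+1%:R^-1.
  by move=> n; apply: iota_dense; rewrite invr_gt0.
move=> /choice[f fw]; exists f.
apply: (@cvg_bound _ _ _ _ _ _ _ (fun n => n.+1%:R^-1)); last exact: cvg_harmonic.
by apply: nearW => n; rewrite rdistC ltW.
Qed.

Lemma J_seq w (f : nat -> H) : iota (f n) @[n --> \oo] --> w ->
  fc qf (f n) @[n --> \oo] --> J w.
Proof.
move=> /cvg_rnormP h.
apply: (@cvg_bound _ _ _ _ _ _ _ (fun n => 2 * rnorm (iota (f n) - w))).
  by apply: nearW => n; rewrite rdistC (rdistC _ (iota _)) J_dist.
by rewrite -[X in _ --> X](mulr0 2); apply: cvgM => //; exact: cvg_cst.
Qed.

Lemma J_linear : linear J.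
Proof.
move=> a w w'; have [f fw] := iota_seq w; have [f' fw'] := iota_seq w'.
have h : iota (a *: f n + f' n) @[n --> \oo] --> a *: w + w'.
  rewrite (_ : (fun n => _) = fun n => a *: iota (f n) + iota (f' n)); last first.
    by apply/funext => n; rewrite linearP.
  by apply: cvgD => //; apply: cvgZ => //; exact: cvg_cst.
have h1 := J_seq _ _ h.
have h2 : fc qf (a *: f n + f' n) @[n --> \oo] --> a *: J w + J w'.
  rewrite (_ : (fun n => _) = fun n => a *: fc qf (f n) + fc qf (f' n)); last first.
    by apply/funext => n; rewrite lq.
  by apply: cvgD; [apply: cvgZ; [exact: cvg_cst|]|]; exact: J_seq.
exact: (cvg_unique (@norm_hausdorff _ H) h1 h2).
Qed.

Lemma JB w w' : J (w - w') = J w - J w'.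
Proof. by rewrite -scaleN1r addrC J_linear scaleN1r addrC. Qed.

Lemma J_ge w : rnorm w <= rnorm (J w).
Proof.
apply/ler_addgt0Pr => e e0; have e3 : 0 < e / 3 by rewrite divr_gt0.
have [f fw] := iota_dense w _ e3.
have h1 := rnorm_dist _ w (iota f) 0; rewrite !subr0 in h1.
have h2 := rnorm_dist _ (fc qf f) (J w) 0; rewrite !subr0 (rdistC _ _ (J w)) in h2.
have := J_dist w f; have := iota_le_qf f; lra.
Qed.

Lemma J_inj w w' : J w = J w' -> w = w'.
Proof.
move=> h; apply/eqP; rewrite -subr_eq0; apply/eqP/rnorm_eq0/eqP.
by rewrite eq_le rnorm_ge0 andbT (le_trans (J_ge _))// JB h subrr rnorm0.
Qed.

(** The range of [fc qf] is the domain of [A], hence dense. If [fc qf (h n)] converges in [H], then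
    [iota (h n)] is Cauchy in H_{-2} by [iota_le_qf], and its limit is the preimage. *)
Lemma J_surj y : exists w, J w = y.
Proof.
have : forall n, exists h, rnorm (y - fc qf h) < n.+1%:R^-1.
  move=> n; have e0 : 0 < (n.+1%:R^-1)%:C :> R[i] by rewrite ltcR invr_gt0.
  have [] := saA.1 (ball y (n.+1%:R^-1)%:C) _ (ball_open y _).
    by exists y; exact: ballxx.
  move=> x []; rewrite -ball_normE /= normE ltcR => xy /(domainP norm_dot saA EA)[h xE].
  by exists h; rewrite -xE.
move=> /choice[h hy].
have hc : fc qf (h n) @[n --> \oo] --> y.
  apply: (@cvg_bound _ _ _ _ _ _ _ (fun n => n.+1%:R^-1)); last exact: cvg_harmonic.
  by apply: nearW => n; rewrite rdistC ltW.
have : cvg (iota (h n) @[n --> \oo]).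
  apply/cauchy_cvgP/cauchy_exP => e e0.
  have eE : e = (complex.Re e)%:C by rewrite RRe_real// gtr0_real.
  have e2 : 0 < complex.Re e / 2 by rewrite divr_gt0// -ltcR -eE.
  have [N _ NP] := @cvg_epsE _ _ _ (@eventually_filter) _ _ _ hc _ e2.
  exists (iota (h N)); exists N => // n /= Nn.
  rewrite -ball_normE /= eE normE ltcR -linearB.
  apply: (le_lt_trans (iota_le_qf _)); rewrite (opB _ lq).
  have := NP N (leqnn N); have := NP n Nn => /=.
  have := rnorm_dist _ (fc qf (h N)) y (fc qf (h n)); rewrite (rdistC _ y); lra.
move=> /cvg_ex[w hw]; exists w.
exact: (cvg_unique (@norm_hausdorff _ H) (J_seq _ _ hw) hc).
Qed.

(** On [H] the map [J] is [fc qf], whose range is the domain. Singular vectors are thus those that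
    [J] sends outside the domain. *)
Lemma iota_domain w : range iota w <-> domain A (J w).
Proof.
split=> [[f _ <-]|/(domainP norm_dot saA EA)[h Jw]].
  by rewrite J_iota; exact: domain_qf.
by exists h => //; apply: J_inj; rewrite J_iota Jw.
Qed.

Lemma cvg_J (w_ : nat -> Hm2) w : J (w_ n) @[n --> \oo] --> J w -> w_ n @[n --> \oo] --> w.
Proof.
move=> /cvg_rnormP h; apply: (@cvg_bound _ _ _ _ _ _ _ (fun n => rnorm (J (w_ n) - J w))) => //.
by apply: nearW => n; rewrite -JB J_ge.
Qed.

(** Common source of the formulas for pairings and functions of [A] on H_{-2}: a map factoring
    through [fc qf] is extended by its continuous factor evaluated at [J w]. *)
Lemma extend_comp (W : normedModType R[i]) (G : H -> W) (T : H -> W) w :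
  (forall f, T f = G (fc qf f)) -> {for J w, continuous G} ->
  get (extend iota T w) = G (J w).
Proof.
move=> TG cG; apply: extend_get; rewrite /extend /=.
have -> : T = G \o fc qf by exact/funext.
exact: (cvg_comp _ _ (J_extend w) cG).
Qed.

Lemma ext_fun_calculusE (g k : measurableTypeR R -> R) w : bmf g -> bmf k ->
  g = (fun t => k t * qf t) -> ext_fun_calculus dot iota E g w = fc k (J w).
Proof.
move=> bg bk gE; rewrite /ext_fun_calculus (fc_fun_calculus norm_dot pE _ bg).
apply: extend_comp => [f|]; first by rewrite gE (fcM norm_dot pE).
have [_ cT] : bounded_operator (fc k).
  by apply/lip_bounded_operator; [exact: fc_linear|exact: fc_lip].
exact: cT.
Qed.

Lemma pairingE h w : pairing dot iota (fc qf h) w = dot h (J w).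
Proof.
apply: (@extend_comp R[i]^o (fun f => dot h f)) => [f|].
  by rewrite (fc_dot norm_dot pE).
apply/cvg_rnormP.
apply: (@squeeze_cvgr _ _ _ _ (fun=> 0) (fun f => rnorm h * rnorm (f - J w))).
- apply: nearW => f; rewrite rnorm_ge0 /= -cabs_rnorm -dotBr.
  exact: (cauchy_schwarz norm_dot).
- exact: cvg_cst.
- rewrite -[X in _ --> X](mulr0 (rnorm h)); apply: cvgM; first exact: cvg_cst.
  by apply/cvg_rnormP; exact: cvg_id.
Qed.

End Hminus2.

(** * Uniqueness of resolvents and estimates of the operator norm *)

Section ResolventSet.
Context {R : realType} {H : completeNormedModType R[i]}.
Implicit Types (T : set (H * H)) (S : H -> H) (z : R[i]).

Lemma is_resolvent_uniq T z S S' : is_resolvent T z S -> is_resolvent T z S' -> S = S'.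
Proof.
move=> [_ hS] [_ hS']; apply/funext => f; apply/hS'.
exact: (iffRL (hS f (S f)) erefl).
Qed.

Lemma resolventE T z S : is_resolvent T z S -> resolvent T z = S.
Proof.
move=> h; apply: (@is_resolvent_uniq T z _ _ _ h).
exact: (@getPex _ [set S0 | is_resolvent T z S0] (ex_intro _ S h)).
Qed.

(** The real [sup] is meaningful only for a nonempty bounded set; [S 0 = 0] supplies the element 0,
    which also gives the lower bound. *)
Lemma opnorm_bound S (C : R) : (forall f, rnorm f <= 1 -> rnorm (S f) <= C) ->
  S 0 = 0 -> 0 <= opnorm S <= C.
Proof.
move=> SC S0.
have ub : ubound [set rnorm (S f) | f in [set f | rnorm f <= 1]] C.
  by move=> _ [f f1 <-]; exact: SC.
have m0 : [set rnorm (S f) | f in [set f : H | rnorm f <= 1]] 0.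
  by exists 0; rewrite /= ?S0 rnorm0.
rewrite /opnorm; apply/andP; split.
  by apply: ub_le_sup => //; exists C.
by apply: ge_sup => //; exists 0.
Qed.

End ResolventSet.

(** * Krein's formula and its continuity *)

Section Perturbation.
Context {R : realType} {H : completeNormedModType R[i]} {dot : {dot H for Num.conj}}.
Context (norm_dot : forall u : H, `|u| ^+ 2 = dot u u).
Context {A : set (H * H)} (saA : self_adjoint dot A).
Context {E : set (measurableTypeR R) -> H -> H} (EA : spectral_measure_of dot A E).
Context {Hm2 : completeNormedModType R[i]} {iota : {linear H -> Hm2}}.
Context (complHm2 : is_Hminus2 dot iota E).
Implicit Types (f g h u v y : H) (w : Hm2).

Local Notation pE := (sm_pvm EA).
Local Notation fc := (fc norm_dot pE).
Local Notation J := (@J R H dot E Hm2 iota).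

Section FixedPoint.
Context (z : R[i]) (Rz : H -> H) (resA : is_resolvent A z Rz).

Let lR : linear Rz. Proof. exact: resA.1.1. Qed.
Let bR : lip Rz. Proof. by apply/(lip_bounded_operator _ lR); exact: resA.1. Qed.
Let lq : linear (fc qf). Proof. by apply: fc_linear; exact: bmf_qf. Qed.
Let le : linear (fc ef). Proof. by apply: fc_linear; exact: bmf_ef. Qed.
Let bq : lip (fc qf). Proof. by apply: fc_lip; exact: bmf_qf. Qed.
Let be : lip (fc ef). Proof. by apply: fc_lip; exact: bmf_ef. Qed.

Lemma res_graph f : A (Rz f, f + z *: Rz f).
Proof. by apply/resA.2. Qed.

(* Rz = (A^2 + 1)^(-1/2) rootR, so that <Rz f, w> = (rootR f, J w). *)
Definition rootR f : H := fc qf (Rz f) + fc ef (f + z *: Rz f).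

Lemma rootR_linear : linear rootR.
Proof.
move=> a u v; rewrite /rootR lR (lq a).
have -> : a *: u + v + z *: (a *: Rz u + Rz v) =
    a *: (u + z *: Rz u) + (v + z *: Rz v).
  by rewrite !scalerDr !scalerA (mulrC z a) addrACA.
by rewrite le scalerDr addrACA.
Qed.

Lemma rootR_lip : lip rootR.
Proof.
have [C C0 hq] := bq; have [D D0 he] := be; have [B B0 hR] := bR.
exists (C * B + D * (1 + cabs z * B)).
  by rewrite addr_ge0 ?mulr_ge0 ?addr_ge0 ?mulr_ge0 ?cabs_ge0.
move=> u; rewrite /rootR (le_trans (rnormD _ _ _))// mulrDl lerD//.
  by rewrite (le_trans (hq _))// -mulrA ler_wpM2l.
rewrite (le_trans (he _))// -mulrA ler_wpM2l// (le_trans (rnormD _ _ _))//.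
by rewrite rnormZ mulrDl mul1r lerD2l -mulrA ler_wpM2l ?cabs_ge0.
Qed.

Lemma rootRE f : Rz f = fc qf (rootR f).
Proof. exact: (graph_repr norm_dot saA EA _ _ (res_graph f)). Qed.

Lemma pairing_res f w : pairing dot iota (Rz f) w = dot (rootR f) (J w).
Proof. by rewrite rootRE (pairingE norm_dot EA complHm2). Qed.

(* For g = J w2: krein_vec g = (A - z)^-1 w2, split as
   A (A^2 + 1)^-1 w2 + (A - z)^-1 source g with source g in H. *)
Definition source g : H := fc qf g + z *: fc ef g.
Definition krein_vec g : H := fc ef g + Rz (source g).

Lemma source_cvg (g_ : nat -> H) g : g_ n @[n --> \oo] --> g ->
  source (g_ n) @[n --> \oo] --> source g.
Proof.
move=> gn; apply: cvgD; first exact: (lip_cvg _ lq _ _ _ _ bq gn).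
by apply: cvgZ; [exact: cvg_cst|exact: (lip_cvg _ le _ _ _ _ be gn)].
Qed.

Lemma krein_vec_cvg (g_ : nat -> H) g : g_ n @[n --> \oo] --> g ->
  krein_vec (g_ n) @[n --> \oo] --> krein_vec g.
Proof.
move=> gn; apply: cvgD; first exact: (lip_cvg _ le _ _ _ _ be gn).
exact: (lip_cvg _ lR _ _ _ _ bR (source_cvg _ _ gn)).
Qed.

(** If it vanishes, then [fc ef g] lies in the domain and [A] maps it to [- fc qf g]. Formally this
    says (A^2 + 1)^(1/2) g = 0; the argument is carried out inside windows. *)
Lemma krein_vec_eq0 g : krein_vec g = 0 -> g = 0.
Proof.
move=> c0.
have Aeta : A (fc ef g, - fc qf g).
  have -> : fc ef g = Rz (- source g).
    by rewrite (opN _ lR); apply/eqP; rewrite -addr_eq0; exact/eqP.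
  have := res_graph (- source g).
  have -> : Rz (- source g) = fc ef g.
    by rewrite (opN _ lR); apply/esym/eqP; rewrite -addr_eq0; exact/eqP.
  by rewrite /source opprD addrNK.
have h n : E (window n) g = 0.
  have mn := @measurable_window R n; have ba := @bmf_af R n; have bw := @bmf_window R n.
  have bqf := @bmf_qf R; have bef := @bmf_ef R.
  have lw := pvm_linear pE _ mn.
  have h1 : fc (af n) (fc ef g) + E (window n) (fc qf g) = 0.
    by rewrite -(window_graph norm_dot saA EA n _ _ Aeta) (opN _ lw) addNr.
  have : fc qf (fc (af n) (fc ef g) + E (window n) (fc qf g)) = 0 by rewrite h1 (op0 _ lq).
  have b1 := bmfM _ _ bqf ba; have b2 := bmfM _ _ bqf bw.
  have b3 := bmfM _ _ b1 bef; have b4 := bmfM _ _ b2 bqf.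
  rewrite -!(fc_pvm norm_dot pE)// (opD _ lq) -!(fcM norm_dot pE)// -(fcD norm_dot pE)// => <-.
  congr (fc _ g); apply/funext => t.
  by rewrite /af /ef -[LHS]mulr1 -(qf_sqr t); ring.
have h1 := pvm_window_cvg norm_dot pE g.
rewrite (_ : (fun n => E (window n) g) = cst 0) in h1; last exact/funext.
exact: (cvg_unique (@norm_hausdorff _ H) h1 (cvg_cst _)).
Qed.

Context (alpha : R[i]).

(** The sum [tau + dot ...] is the renormalized pairing of (A - z)^-1 w2 with w1, where f = J w1 and
    g = J w2. Zeros of the coefficient correspond to eigenvalues of the perturbed operator. *)
Definition krein_coef tau f g : R[i] := 1 + alpha * (tau + dot (rootR (source g)) f).

(** With h = phi + b A (A^2 + 1)^-1 w2 the resolvent equation becomes (A - z) phi = f + b source(g).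
    Inserting this phi into the boundary condition leaves one scalar linear equation for [b]. *)
Lemma perturbation_graph tau w1 w2 f h :
  perturbation dot iota A E alpha tau w1 w2 (h, f + z *: h) <->
  exists b, h = Rz f + b *: krein_vec (J w2) /\
            b * krein_coef tau (J w1) (J w2) = - alpha * dot (rootR f) (J w1).
Proof.
set g := J w2; set f1 := J w1.
have etaE : ext_fun_calculus dot iota E (fun t => t / (t ^+ 2 + 1)) w2 = fc ef g.
  apply: (ext_fun_calculusE norm_dot EA complHm2); [|exact: bmf_ef|exact: tfE].
  rewrite -[X in bmf X]/tf tfE; apply: bmfM; [exact: bmf_ef|exact: bmf_qf].
have zetaE : ext_fun_calculus dot iota E (fun t => (t ^+ 2 + 1)^-1) w2 = fc qf g.
  apply: (ext_fun_calculusE norm_dot EA complHm2); [|exact: bmf_qf|exact: zfE].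
  rewrite -[X in bmf X]/zf zfE; apply: bmfM; exact: bmf_qf.
have gamE b : Rz (f + b *: source g) = Rz f + b *: Rz (source g) /\
  dot (rootR (f + b *: source g)) f1 = dot (rootR f) f1 + b * dot (rootR (source g)) f1.
  rewrite (opD _ lR) (opZ _ lR) (opD _ rootR_linear) (opZ _ rootR_linear).
  by rewrite dotDl dotZl.
rewrite /perturbation etaE zetaE /=; split.
- move=> [phi [Aphi [b [Ap bE [hE fE]]]]].
  have phiE : phi = Rz (f + b *: source g).
    apply/resA.2; have -> : f + b *: source g + z *: phi = Aphi; last exact: Ap.
    have -> : Aphi = f + z *: h + b *: fc qf g by rewrite fE subrK.
    rewrite hE /source !scalerDr !scalerA (mulrC z b) -!addrA; congr (_ + _).
    by rewrite [RHS]addrA [RHS]addrC; congr (_ + _); exact: addrC.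
  have [g1 g2] := gamE b.
  exists b; split.
    by rewrite hE phiE g1 /krein_vec scalerDr -addrA; congr (_ + _); rewrite addrC.
  move: bE; rewrite phiE pairing_res g2 /krein_coef => bE.
  by rewrite mulrDr mulr1 {1}bE; ring.
- move=> [b [hE bE]]; have [g1 g2] := gamE b.
  exists (Rz (f + b *: source g)), (f + b *: source g + z *: Rz (f + b *: source g)), b; split.
  + exact: res_graph.
  + rewrite pairing_res g2 -/f1.
    have e : b = b * krein_coef tau f1 g - b * (alpha * (tau + dot (rootR (source g)) f1)).
      by rewrite /krein_coef; ring.
    by rewrite {1}e bE; ring.
  + have hE' : h = Rz (f + b *: source g) + b *: fc ef g.
      by rewrite hE g1 /krein_vec scalerDr -addrA; congr (_ + _); exact: addrC.
    rewrite -hE'; congr (_, _); rewrite {1}hE' /source !scalerDr !scalerA (mulrC z b).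
    rewrite -!addrA; congr (_ + _).
    by rewrite [RHS]addrC addrA subrK addrC.
Qed.

(** Krein's formula, with [b] solved from [perturbation_graph]. A vanishing coefficient makes the
    quotient 0 by convention, and the formula then gives [Rz]. *)
Definition presolvent tau f1 g f : H :=
  Rz f - (alpha / krein_coef tau f1 g * dot (rootR f) f1) *: krein_vec g.

Lemma presolvent_bounded tau f1 g : bounded_operator (presolvent tau f1 g).
Proof.
have [C C0 hR] := bR; have [D D0 hQ] := rootR_lip.
have lin : linear (presolvent tau f1 g).
  move=> a u v; rewrite /presolvent lR rootR_linear dotDl dotZl.
  rewrite scalerBr addrACA -opprD scalerA -scalerDl; congr (_ - _ *: _); ring.
apply/(lip_bounded_operator _ lin).
exists (C + cabs (alpha / krein_coef tau f1 g) * D * rnorm f1 * rnorm (krein_vec g)).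
  by rewrite addr_ge0 ?mulr_ge0 ?cabs_ge0 ?rnorm_ge0.
move=> u; rewrite (le_trans (rnormB _ _ _))// mulrDl lerD// rnormZ cabsM.
have -> : cabs (alpha / krein_coef tau f1 g) * D * rnorm f1 * rnorm (krein_vec g) * rnorm u =
  cabs (alpha / krein_coef tau f1 g) * ((D * rnorm u) * rnorm f1) * rnorm (krein_vec g) by ring.
rewrite ler_wpM2r ?rnorm_ge0// ler_wpM2l ?cabs_ge0//.
by rewrite (le_trans (cauchy_schwarz norm_dot _ _))// ler_wpM2r ?rnorm_ge0.
Qed.

Lemma perturbation_resolvent tau w1 w2 : krein_coef tau (J w1) (J w2) != 0 ->
  is_resolvent (perturbation dot iota A E alpha tau w1 w2) z
    (presolvent tau (J w1) (J w2)).
Proof.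
move=> g0; split; first exact: presolvent_bounded.
move=> f h; rewrite perturbation_graph /presolvent; split.
  move=> [b [-> bE]]; rewrite -scaleNr; congr (_ + _ *: _).
  by apply: (mulIf g0); rewrite bE; field.
move=> ->; exists (- (alpha / krein_coef tau (J w1) (J w2) * dot (rootR f) (J w1))).
by rewrite -scaleNr; split=> //; field.
Qed.

(** If the coefficient vanished, f = 0 and b = 1 would solve the scalar equation, making
    [krein_vec (J w2)] an eigenvector at [z]; it is nonzero by [krein_vec_eq0]. *)
Lemma krein_coef_neq0 tau w1 w2 : J w2 != 0 ->
  resolvent_set (perturbation dot iota A E alpha tau w1 w2) z ->
  krein_coef tau (J w1) (J w2) != 0.
Proof.
move=> g0 [S [[lS _] hS]]; apply: contra_neq g0 => gam0.
apply: krein_vec_eq0.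
have : perturbation dot iota A E alpha tau w1 w2 (krein_vec (J w2), 0 + z *: krein_vec (J w2)).
  apply/perturbation_graph; exists 1; rewrite (op0 _ lR) (op0 _ rootR_linear) add0r.
  by rewrite scale1r gam0 dot0l !mulr0.
by move/hS ->; exact: op0.
Qed.

Lemma krein_coef_cvg tau (f_ g_ : nat -> H) f1 g :
  f_ n @[n --> \oo] --> f1 -> g_ n @[n --> \oo] --> g ->
  (krein_coef tau (f_ n) (g_ n) : R[i]^o) @[n --> \oo] --> (krein_coef tau f1 g : R[i]^o).
Proof.
move=> fn gn; apply: cvgD; first exact: cvg_cst.
apply: cvgM; first exact: cvg_cst.
apply: cvgD; first exact: cvg_cst.
apply: (dot_cvg norm_dot) => //.
by apply: (lip_cvg _ rootR_linear _ _ _ _ rootR_lip); exact: source_cvg.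
Qed.

(** The terms [Rz] cancel, and the rest depends on the argument only through [rootR u], bounded by
    [D] on the unit ball; this gives convergence in norm. *)
Lemma presolvent_cvg tau (f_ g_ : nat -> H) f1 g :
  f_ n @[n --> \oo] --> f1 -> g_ n @[n --> \oo] --> g -> krein_coef tau f1 g != 0 ->
  opnorm (fun f => presolvent tau (f_ n) (g_ n) f - presolvent tau f1 g f)
    @[n --> \oo] --> (0 : R).
Proof.
move=> fn gn g0; have [D D0 hQ] := rootR_lip.
pose v := (alpha / krein_coef tau f1 g) *: krein_vec g.
pose v_ n := (alpha / krein_coef tau (f_ n) (g_ n)) *: krein_vec (g_ n).
have vn : v_ n @[n --> \oo] --> v.
  apply: cvgZ; last exact: krein_vec_cvg.
  apply: cvgM; first exact: cvg_cst.
  by apply: cvgV => //; exact: krein_coef_cvg.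
have /cvg_rnormP vn0 := vn; have /cvg_rnormP fn0 := fn.
pose B n := D * ((rnorm f1 + rnorm (f_ n - f1)) * rnorm (v_ n - v) + rnorm (f_ n - f1) * rnorm v).
have B0 : B n @[n --> \oo] --> (D * ((rnorm f1 + 0) * 0 + 0 * rnorm v) : R).
  apply: cvgM; first exact: cvg_cst.
  apply: cvgD; last by apply: cvgM => //; exact: cvg_cst.
  by apply: cvgM => //; apply: cvgD => //; exact: cvg_cst.
rewrite mulr0 mul0r addr0 mulr0 in B0.
apply: (@squeeze_cvgr _ _ _ _ (fun=> 0) B) => //; last exact: cvg_cst.
apply: nearW => n; apply: opnorm_bound; last first.
  by rewrite /presolvent (op0 _ lR) (op0 _ rootR_linear) !dot0l !mulr0 !scale0r !subrr.
move=> u u1.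
(* The product rule for the difference of two rank-one operators, the scalar quotients being
   absorbed into [v_ n] and [v]. *)
have -> : presolvent tau (f_ n) (g_ n) u - presolvent tau f1 g u =
    - (dot (rootR u) (f_ n) *: (v_ n - v) + dot (rootR u) (f_ n - f1) *: v).
  rewrite dotBr scalerBr scalerBl addrA subrK opprB /v_ /v !scalerA /presolvent.
  rewrite opprB addrC addrA subrK (mulrC (dot _ f1)) (mulrC (dot _ (f_ n))).
  by [].
rewrite rnormN (le_trans (rnormD _ _ _))// !(rnormZ _ (dot _ _)) /B /= (mulrDr D) !mulrA.
have hu : rnorm (rootR u) <= D.
  by rewrite (le_trans (hQ u))// -[leRHS]mulr1 ler_wpM2l.
apply: lerD; rewrite ler_wpM2r ?rnorm_ge0// (le_trans (cauchy_schwarz norm_dot _ _))//.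
  rewrite ler_pM ?rnorm_ge0//.
  by have := rnormD _ f1 (f_ n - f1); rewrite addrC subrK.
by rewrite ler_wpM2r ?rnorm_ge0.
Qed.

End FixedPoint.
End Perturbation.

(** * Complex measures: independence of the decomposition, and total variation *)

Section ComplexMeasure.
Context {R : realType}.
Implicit Types (m n : {finite_measure set (measurableTypeR R) -> \bar R}).
Implicit Types (nu : set (measurableTypeR R) -> R[i]) (f : R -> R).

(** The positive measures m1 + n2 and n1 + m2 coincide, and all four integrals are finite, so they
    can be moved across the equality. *)
Lemma integral_diff_uniq m1 m2 n1 n2 f :
  (forall D, measurable D -> fine (m1 D) - fine (m2 D) = fine (n1 D) - fine (n2 D)) ->
  m1.-integrable setT (EFin \o f) -> m2.-integrable setT (EFin \o f) ->
  n1.-integrable setT (EFin \o f) -> n2.-integrable setT (EFin \o f) ->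
  \int[m1]_t f t - \int[m2]_t f t = \int[n1]_t f t - \int[n2]_t f t.
Proof.
move=> mn i1 i2 j1 j2.
have e : (\int[measure_add m1 n2]_t (f t)%:E = \int[measure_add n1 m2]_t (f t)%:E)%E.
  apply: eq_measure_integral => D mD _; apply: etrans (measure_addE _ _ _) _.
  apply: etrans _ (esym (measure_addE _ _ _)).
  have key (a b c e : \bar R) : a \is a fin_num -> b \is a fin_num -> c \is a fin_num ->
      e \is a fin_num -> fine a - fine b = fine c - fine e -> (a + e = c + b)%E.
    case: a b c e => [a||] [b||] [c||] [e||]//= _ _ _ _ h.
    by rewrite -!EFinD; congr (_%:E); lra.
  by apply: key; [exact: fin_num_measure..|exact: mn].
have fin m : m.-integrable setT (EFin \o f) -> (\int[m]_t (f t)%:E)%E = (\int[m]_t f t)%:E.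
  by move=> i; rewrite fineK//; exact: (integrable_fin_num measurableT i).
move: e; rewrite !integral_measure_add// !fin// -!EFinD => -[]; lra.
Qed.

Lemma cintegralE nu f (p1 p2 p3 p4 : {finite_measure set (measurableTypeR R) -> \bar R}) :
  (forall D, measurable D -> nu D =
    (fine (p1 D) - fine (p2 D)) +i* (fine (p3 D) - fine (p4 D))) ->
  p1.-integrable setT (EFin \o f) -> p2.-integrable setT (EFin \o f) ->
  p3.-integrable setT (EFin \o f) -> p4.-integrable setT (EFin \o f) ->
  cintegral nu f = (\int[p1]_t f t - \int[p2]_t f t)
              +i* (\int[p3]_t f t - \int[p4]_t f t).
Proof.
move=> nuE i1 i2 i3 i4; rewrite /cintegral; set X := (X in get X).
have : X (get X) by apply: getPex; eexists; exists p1, p2, p3, p4; split.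
move=> [q1 [q2 [q3 [q4 [nuE' [j1 j2] [j3 j4] ->]]]]].
have e D : measurable D -> (fine (q1 D) - fine (q2 D)) +i* (fine (q3 D) - fine (q4 D)) =
    (fine (p1 D) - fine (p2 D)) +i* (fine (p3 D) - fine (p4 D)).
  by move=> mD; rewrite -nuE// nuE'.
by congr (_ +i* _); apply: integral_diff_uniq => // D /e[].
Qed.

(** Every partition sum is bounded by the corresponding sum for [m], which is [m D] by
    sigma-additivity. *)
Lemma cmeasure_variation_le nu (m : {measure set (measurableTypeR R) -> \bar R}) D :
  nu set0 = 0 -> measurable D ->
  (forall D, measurable D -> ((cabs (nu D))%:E <= m D)%E) ->
  (0 <= cmeasure_variation nu D <= m D)%E.
Proof.
move=> nu0 mD num; apply/andP; split.
  (* The partition D, empty, empty, ... shows that the supremum runs over a nonempty family. *)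
  apply: (@le_trans _ _ (\sum_(0 <= k <oo) (cabs (nu (bigcup2 D set0 k)))%:E)%E).
    by apply: nneseries_ge0 => k _ _; rewrite lee_fin cabs_ge0.
  apply: ereal_sup_ubound; exists (bigcup2 D set0); split=> //.
  - by move=> [|[|k]] /=; [exact: mD|exact: measurable0|exact: measurable0].
  - by rewrite -trivIset_bigcup2 setI0.
  - by rewrite bigcup2E setU0.
apply: ge_ereal_sup => _ [F [mF tF FD ->]].
rewrite -FD measure_semi_bigcup//; last by rewrite FD.
by apply: lee_nneseries => k _; [rewrite lee_fin cabs_ge0|exact: num].
Qed.

End ComplexMeasure.

(** * Existence and value of the form for pairs with bounded support *)

Section Form.
Context {R : realType} {H : completeNormedModType R[i]} {dot : {dot H for Num.conj}}.
Context (norm_dot : forall u : H, `|u| ^+ 2 = dot u u).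
Context {A : set (H * H)} (saA : self_adjoint dot A).
Context {E : set (measurableTypeR R) -> H -> H} (EA : spectral_measure_of dot A E).
Implicit Types (f g u v : H).

Local Notation pE := (sm_pvm EA).
Local Notation mu := (specm norm_dot pE).
Local Notation fc := (fc norm_dot pE).
Local Notation Q := (fc_form norm_dot pE).
Local Notation mW := (@measurable_window R).

Lemma pvm_fc D (k : measurableTypeR R -> R) u : measurable D -> bmf k ->
  E D (fc k u) = fc k (E D u).
Proof. by move=> mD /(fcP norm_dot pE)[_ _ c _]; exact: c. Qed.

Lemma af_window n m u : (n <= m)%N -> fc (af m) (E (window n) u) = fc (af n) u.
Proof.
move=> nm; have mn := mW n; have ba := @bmf_af R m; have bw := @bmf_window R n.
rewrite -(fc_pvm norm_dot pE)// -(fcM norm_dot pE)//; congr (fc _ u).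
apply/funext => t; rewrite /af !indicE -mulrA -natrM mulnb -in_setI.
by rewrite (setIidr (windowS n m nm)).
Qed.

Lemma window_af n u : E (window n) (fc (af n) u) = fc (af n) u.
Proof.
have mn := mW n; have ba := @bmf_af R n.
by rewrite pvm_fc// af_window.
Qed.

Lemma domain_pvm_closed S u : measurable S -> domain A u -> domain A (E S u).
Proof.
move=> mS [y Auy]; apply: (domain_of_bound norm_dot EA _ (rnorm y)) => n.
rewrite -pvm_fc//; last exact: bmf_af.
rewrite (le_trans (pvm_contract norm_dot pE _ mS _))//.
exact: (bound_of_domain norm_dot saA EA).
Qed.

(* The complex measure D |-> (E(D) g, f) lives on a bounded set. *)
Definition bounded_pair n g f :=
  forall D, measurable D -> dot (E D g) f = dot (E D (E (window n) g)) f.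

Section BoundedPair.
Context (n : nat) (g f : H) (gf : bounded_pair n g f).

Let W : set (measurableTypeR R) := window n.
Let G := E W g.
Let F := E W f.
Let mWn : measurable W := mW n.

Lemma bounded_pairE D : measurable D -> dot (E D g) f = dot (E D G) F.
Proof.
move=> mD; rewrite gf// -/W -/G -(pvm_adjoint pE)//; congr (dot _ f).
by rewrite /G !(pvmI pE)//; [congr (E _ g); apply/seteqP; split=> t [] //= ? []|exact: measurableI].
Qed.

Lemma bounded_pair_integrable u : (mu (E W u)).-integrable setT (EFin \o id).
Proof. by apply: integrable_domain; exact: domain_window. Qed.

Lemma bounded_pair_Q u : \int[mu (E W u)]_t t = Q (af n) u.
Proof.
have mid : measurable_fun [set: measurableTypeR R] (EFin \o (id : R -> R)).
  by apply/measurable_EFinP; exact: measurable_id.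
rewrite /fc_form /Rintegral specm_restr//.
congr fine; rewrite [LHS]integral_mkcond; congr (integral _ _ _); apply/funext => t.
by rewrite patchE /af indicE; case: ifP => _; rewrite ?mulr1 ?mulr0.
Qed.

(** By Cauchy-Schwarz the variation is dominated by [mu G + mu F]. The truncated vectors [G] and [F]
    lie in the domain, so both measures have a finite first moment. *)
Lemma bounded_pair_exists :
  (\int[cmeasure_variation (fun D => dot (E D g) f)]_t (`|t|)%:E < +oo)%E.
Proof.
have mabs : measurable_fun [set: measurableTypeR R] (fun t => (`|t|)%:E).
  by apply/measurable_EFinP; exact: normr_measurable.
have nu0 : dot (E set0 g) f = 0 by rewrite (pvm_set0 pE) dot0l.
have num D : measurable D ->
    ((cabs (dot (E D g) f))%:E <= measure_add (mu G) (mu F) D)%E.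
  move=> mD; rewrite measure_addE !specmE// -EFinD lee_fin bounded_pairE// (pvm_dot pE)//.
  apply: (le_trans (cauchy_schwarz norm_dot _ _)).
  have := sqr_ge0 (rnorm (E D G) - rnorm (E D F)).
  have := sqr_ge0 (rnorm (E D G)); have := sqr_ge0 (rnorm (E D F)); rewrite sqrrB; lra.
have vle D : measurable D -> (0 <= cmeasure_variation (fun D => dot (E D g) f) D <=
    measure_add (mu G) (mu F) D)%E.
  by move=> mD; apply: cmeasure_variation_le.
have v0 : cmeasure_variation (fun D => dot (E D g) f) set0 = 0%E.
  by apply/eqP; rewrite eq_le andbC; have := vle _ measurable0;
    rewrite measure_addE !measure0 adde0.
apply: (@le_lt_trans _ _ (\int[measure_add (mu G) (mu F)]_t (`|t|)%:E)%E).
  apply: le_set_function_integral => //.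
rewrite ge0_integral_measure_add//.
have /integrableP[_ h1] := bounded_pair_integrable g.
have /integrableP[_ h2] := bounded_pair_integrable f.
exact: lte_add_pinfty.
Qed.

(** Polarization writes the complex measure through four spectral measures, the decomposition that
    [cintegral] asks for, and the same polarization evaluates the right side. *)
Lemma bounded_pair_value : cintegral (fun D => dot (E D g) f) id = dot (fc (af n) g) f.
Proof.
(* Halving the vectors absorbs the factor 4 of polarization, so the four measures enter without
   coefficients. *)
pose half u := (2^-1)%:C *: u.
pose x1 := half (g + f); pose x2 := half (g - f).
pose x3 := half (g + 'i%C *: f); pose x4 := half (g - 'i%C *: f).
have lW := pvm_linear pE _ mWn.
have polE (T : H -> H) (q : H -> R) : linear T ->
    (forall u, dot (T u) u = (q u)%:C) ->
    dot (T g) f = (q x1 - q x2) +i* (q x3 - q x4).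
  move=> lT qT.
  have hT u : dot (T (half u)) (half u) = (4^-1)%:C * dot (T u) u.
    rewrite (opZ _ lT) dotZl dotZr mulrA.
    have -> : Num.conj (2^-1)%:C = (2^-1)%:C :> R[i] by apply/CrealP; rewrite complex_real.
    by rewrite -rmorphM; congr (_%:C * _); field.
  have P : pol (fun x => dot (T x) x) g f = 4%:R * dot (T g) f.
    by apply: (polarization (fun x y => dot (T x) y)) => *;
      rewrite ?opD ?opZ// ?dotDl ?dotDr ?dotZl ?dotZr.
  have -> : dot (T g) f = (4^-1)%:C * pol (fun x => dot (T x) x) g f.
    have e4 : (4%:R : R[i]) = (4%:R : R)%:C by rewrite rmorph_nat.
    by rewrite P mulrA e4 -rmorphM mulVf ?mul1r// pnatr_eq0.
  have -> : (4^-1)%:C * pol (fun x => dot (T x) x) g f =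
      (q x1)%:C - (q x2)%:C + 'i%C * ((q x3)%:C - (q x4)%:C).
    by rewrite -!qT !hT /pol; ring.
  by rewrite -!rmorphB [RHS]complexE.
have h D : measurable D -> dot (E D g) f =
    (fine (mu (E W x1) D) - fine (mu (E W x2) D)) +i*
    (fine (mu (E W x3) D) - fine (mu (E W x4) D)).
  move=> mD; rewrite gf//.
  have mDW : measurable (D `&` W) by exact: measurableI.
  rewrite (polE (fun u => E D (E W u)) (fun u => fine (mu (E W u) D)))//.
    exact: (linear_comp _ _ (pvm_linear pE _ mD) lW).
  move=> u; rewrite specmE//= !(pvmI pE)// (pvm_dot pE)//.
  by rewrite (dotE norm_dot).
rewrite (cintegralE _ _ _ _ _ _ h); try exact: bounded_pair_integrable.
rewrite !bounded_pair_Q; apply/esym; apply: polE; first by apply: fc_linear; exact: bmf_af.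
by have [_ _ _ qT] := fcP norm_dot pE _ (@bmf_af R n).
Qed.

End BoundedPair.

End Form.

(** * Construction of the approximating pair *)

Section Approximation.
Context {R : realType} {H : completeNormedModType R[i]} {dot : {dot H for Num.conj}}.
Context (norm_dot : forall u : H, `|u| ^+ 2 = dot u u).
Context {A : set (H * H)} (saA : self_adjoint dot A).
Context {E : set (measurableTypeR R) -> H -> H} (EA : spectral_measure_of dot A E).
Implicit Types (f g u v : H).

Local Notation pE := (sm_pvm EA).
Local Notation fc := (fc norm_dot pE).
Local Notation mW := (@measurable_window R).

Lemma window_near u (e : R) : 0 < e -> exists n, rnorm (E (window n) u - u) < e.
Proof.
move=> e0.
have [n _ h] := @cvg_epsE _ _ _ (@eventually_filter) _ _ _ (pvm_window_cvg norm_dot pE u) e e0.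
by exists n; exact: (h n (leqnn n)).
Qed.

(* f' keeps the part E(S) f of f and truncates the part E(S^c) f, while g' is a
   truncation of g plus a small multiple of E(S^c) f: the two unbounded parts
   are then carried by disjoint sets.  The small multiple of A E(window) f'
   adjusts the value of the form, which is possible since the functional
   u |-> (A u, f') is unbounded. *)
Lemma approx_pair f g (tau : R[i]) (e : R) : ~ domain A f -> 0 < e ->
  exists f' g' n, [/\ rnorm (f' - f) < e, rnorm (g' - g) < e,
    ~ domain A f', ~ domain A g' &
    bounded_pair n g' f' (dot := dot) (E := E) /\ dot (fc (af n) g') f' = tau].
Proof.
move=> nf e0; have [S [mS nS nSC]] := domain_split norm_dot EA _ nf.
have mSC := measurableC mS; pose p := E (~` S) f.
(* One third for each contribution to [g' - g]: the truncation error of [g], the correction, and the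
   multiple of [p]. *)
have e3 : 0 < e / 3 by rewrite divr_gt0.
have [N Np] := window_near p _ e0; have [M Mg] := window_near g _ e3.
have mN := mW N; have mM := mW M.
pose f' := E S f + E (window N) p.
have lS := pvm_linear pE _ mS; have lSC := pvm_linear pE _ mSC.
have lN := pvm_linear pE _ mN.
have fE : f = E S f + p.
  have := fcD norm_dot pE \1_S \1_(~` S) f (bmf_indic _ mS) (bmf_indic _ mSC).
  rewrite !(fc_pvm norm_dot pE)// => <-; rewrite -[LHS](fc1 norm_dot pE).
  congr (fc _ f); apply/funext => t; rewrite !indicE in_setC.
  by case: (t \in S); rewrite ?addr0 ?add0r.
have SNp : E S (E (window N) p) = 0.
  rewrite /p !(pvmI pE)//; last exact: measurableI.
  rewrite (_ : _ `&` _ = set0) ?(pvm_set0 pE)//.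
  by rewrite -subset0 => t /=; tauto.
have SCf' : E (~` S) f' = E (window N) p.
  rewrite /f' (opD _ lSC) (pvmI pE)// setICl (pvm_set0 pE) add0r /p.
  rewrite !(pvmI pE)//; last exact: measurableI.
  by congr (E _ f); rewrite eqEsubset; split=> t /=; tauto.
(* E(S) f' = E(S) f, which is outside the domain by the choice of [S]. *)
have nf' : ~ domain A f'.
  move=> /(domain_pvm_closed norm_dot saA EA _ _ mS).
  by rewrite /f' (opD _ lS) SNp addr0 (pvm_idem pE).
have f'f : rnorm (f' - f) < e.
  by rewrite [X in _ - X]fE /f' opprD addrACA subrr add0r.
pose d : R := e / (3 * (rnorm p + 1)).
have p0 := rnorm_ge0 _ p.
have d0 : 0 < d by rewrite divr_gt0// mulr_gt0// ltr_wpDl.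
have dp : rnorm (d%:C *: p) < e / 3.
  rewrite rnormZ cabs_real gtr0_norm// /d.
  have -> : e / (3 * (rnorm p + 1)) * rnorm p = (e / 3) * (rnorm p / (rnorm p + 1)).
    by field; lra.
  rewrite -[ltRHS]mulr1 ltr_pM2l// ltr_pdivrMr; lra.
(* The defect left for the correction term: [tau] minus what the truncation of [g] and the multiple
   of [p] contribute to the form. *)
pose c0 := tau - dot (fc (af M) g) f' - d%:C * dot p (fc (af N) p).
(* The correction [s *: fc (af L) f'] adds s a^2 to the form, whence s = c0 / a^2, and has norm |c0|
   / a. The threshold makes this norm less than e / 3; the added 1 keeps the threshold, hence [a],
   positive. *)
have [L hL] := unbounded_of_notin norm_dot EA _ nf' (3 * (cabs c0 + 1) / e).
pose a := rnorm (fc (af L) f').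
have c00 := cabs_ge0 c0.
have a0 : 0 < a by apply: lt_trans hL; rewrite divr_gt0//; lra.
pose s := c0 / (a ^+ 2)%:C.
pose g' := E (window M) g + s *: fc (af L) f' + d%:C *: p.
pose K := maxn M (maxn L N).
have MK : (M <= K)%N by exact: leq_maxl.
have LK : (L <= K)%N by rewrite /K; lia.
have NK : (N <= K)%N by rewrite /K; lia.
have mK := mW K; have mL := mW L.
have bK := @bmf_af R K; have bL := @bmf_af R L; have bN := @bmf_af R N.
have lK := pvm_linear pE _ mK; have lf := fc_linear norm_dot pE _ bK.
exists f', g', K; split=> //.
- have -> : g' - g = (E (window M) g - g) + s *: fc (af L) f' + d%:C *: p.
    by rewrite /g' addrAC; congr (_ + _); rewrite addrAC.
  have sa : rnorm (s *: fc (af L) f') < e / 3.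
    rewrite rnormZ -/a /s cabsM cabsV cabs_real ger0_norm ?sqr_ge0//.
    have -> : cabs c0 / a ^+ 2 * a = cabs c0 / a by field; lra.
    rewrite ltr_pdivrMr//; move: hL; rewrite -/a ltr_pdivrMr// => hL.
    have : a * e = 3 * (e / 3 * a) by field.
    lra.
  have h1 := rnormD _ (E (window M) g - g + s *: fc (af L) f') (d%:C *: p).
  have h2 := rnormD _ (E (window M) g - g) (s *: fc (af L) f').
  lra.
(* The first two terms of [g'] lie in ranges of windows, hence in the domain; if [g'] did too, so
   would [p]. *)
- move=> Dg'; apply: nSC; rewrite -/p.
  have D1 : domain A (s *: fc (af L) f' + E (window M) g).
    apply: (domain_comb saA); last exact: domain_window.
    by rewrite -(window_af norm_dot EA); exact: domain_window.
  have D2 := domain_comb saA (-1) _ _ D1 Dg'.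
  have D3 : domain A (d%:C *: p).
    move: D2; congr (domain A _).
    by rewrite scaleN1r /g' (addrC (s *: _)) addrA addNr add0r.
  have := domain_comb saA (d^-1)%:C _ _ D3 (ex_intro _ 0 (graph0 saA)).
  by rewrite addr0 scalerA -rmorphM mulVf ?gt_eqF// scale1r.
- split.
    move=> D mD; apply/eqP; rewrite -subr_eq0 -dotBl -(opB _ (pvm_linear pE _ mD)).
    (* Outside the large window only the multiple of [p] survives. It is carried by the complement
       of [S], where [f'] is [E (window N) p] and lives inside the window, so the pairing
       vanishes. *)
    have -> : g' - E (window K) g' = d%:C *: (p - E (window K) p).
      rewrite /g' !(opD _ lK) !(opZ _ lK) (pvmI pE)// (setIidr (windowS _ _ MK)).
      rewrite -[in E (window K) (fc _ _)](window_af norm_dot EA L) (pvmI pE)//.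
      rewrite (setIidr (windowS _ _ LK)) window_af scalerBr.
      by rewrite opprD addrACA subrr add0r.
    rewrite (opZ _ (pvm_linear pE _ mD)) dotZl (pvm_adjoint pE)//.
    have -> : p - E (window K) p = E (~` S) (p - E (window K) p).
      rewrite (opB _ lSC) (pvm_idem pE)//; congr (_ - _).
      rewrite /p !(pvmI pE)//; last exact: measurableI.
      by congr (E _ f); rewrite eqEsubset; split=> t /=; tauto.
    rewrite (pvm_adjoint pE)//.
    have -> : E (~` S) (E D f') = E (window K) (E D (E (window N) p)).
      have comm D1 D2 u : measurable D1 -> measurable D2 -> E D1 (E D2 u) = E D2 (E D1 u).
        by move=> m1 m2; rewrite !(pvmI pE)// setIC.
      rewrite comm// SCf' [RHS]comm//; congr (E D _).
      by rewrite (pvmI pE)// (setIidr (windowS _ _ NK)).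
    rewrite -(pvm_adjoint pE)// (opB _ lK) (pvm_idem pE)// subrr dot0l mulr0.
    by [].
rewrite /g' !(opD _ lf) !(opZ _ lf) (af_window norm_dot EA)// !dotDl !dotZl.
have -> : dot (fc (af K) (fc (af L) f')) f' = (a ^+ 2)%:C.
  rewrite -[in fc (af L) f'](window_af norm_dot EA) af_window// (fc_dot norm_dot pE)//.
  by rewrite (dotE norm_dot).
have -> : dot (fc (af K) p) f' = dot p (fc (af N) p).
  rewrite (fc_dot norm_dot pE)//.
  have pS : E (~` S) p = p by exact: (pvm_idem pE _ mSC).
  rewrite -[in LHS]pS (pvm_adjoint pE)// (pvm_fc norm_dot EA)// SCf'.
  by rewrite (af_window norm_dot EA).
rewrite /s /c0 mulfVK; first by ring.
by rewrite eq_complex /= eqxx andbT expf_eq0 /= gt_eqF.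
Qed.

End Approximation.

Theorem theorem5 (R : realType)
  (H : completeNormedModType R[i]) (dot : {dot H for Num.conj})
  (norm_dot : forall u : H, `|u| ^+ 2 = dot u u)
  (sepH : separable H)
  (A : set (H * H)) (saA : self_adjoint dot A) (sbA : bounded_from_below dot A)
  (E : set (measurableTypeR R) -> H -> H) (EA : spectral_measure_of dot A E)
  (Hm2 : completeNormedModType R[i]) (iota : {linear H -> Hm2})
  (complHm2 : is_Hminus2 dot iota E)
  (w1 w2 : Hm2) (z : R[i]) (rhoz : resolvent_set A z)
  (not_exists : ~ resolvent_form_exists dot iota E w1 w2 z)
  (alpha tau : R[i]) (alpha0 : alpha != 0)
  (At : set (H * H)) (AtP : class_Ptau dot iota A E alpha tau w1 w2 At) :
  exists (w1n w2n : nat -> Hm2) (An : nat -> set (H * H)),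
    [/\ w1n n @[n --> \oo] --> w1,
        w2n n @[n --> \oo] --> w2,
        (form_value dot iota E (w1n n) (w2n n) : R[i]^o) @[n --> \oo]
          --> (tau : R[i]^o),
        forall n, class_P dot iota A E alpha (w1n n) (w2n n) (An n) &
        norm_resolvent_cvg A An At].
Proof.
have [[n1 n2 n12] _ ->] := AtP.
pose J := @J R H dot E Hm2 iota.
have nf : ~ domain A (J w1) by move=> /(iota_domain norm_dot saA EA complHm2).
have fg : 0 < rnorm (J w1 - J w2).
  rewrite lt_neqAle rnorm_ge0 andbT; apply/eqP => /esym/rnorm_eq0/eqP.
  by rewrite subr_eq0 => /eqP/(J_inj norm_dot EA complHm2).
(* The first bound gives convergence; half the distance between [J w1] and [J w2] keeps the two
   approximants distinct. *)
pose e n : R := Num.min n.+1%:R^-1 (rnorm (J w1 - J w2) / 2).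
have e0 n : 0 < e n by rewrite lt_min invr_gt0 ltr0n divr_gt0.
have ex n : exists p : Hm2 * Hm2 * nat,
    [/\ rnorm (J p.1.1 - J w1) < e n, rnorm (J p.1.2 - J w2) < e n,
        ~ domain A (J p.1.1), ~ domain A (J p.1.2) &
        bounded_pair p.2 (J p.1.2) (J p.1.1) (dot := dot) (E := E) /\
        dot (fc norm_dot (sm_pvm EA) (af p.2) (J p.1.2)) (J p.1.1) = tau].
  have [f' [g' [k h]]] := approx_pair norm_dot saA EA _ (J w2) tau _ nf (e0 n).
  have [u uE] := J_surj norm_dot saA EA complHm2 f'.
  have [v vE] := J_surj norm_dot saA EA complHm2 g'.
  by exists (u, v, k); rewrite /= /J uE vE.
have [p pP] := choice ex.
pose w1n n := (p n).1.1; pose w2n n := (p n).1.2.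
have value n : form_value dot iota E (w1n n) (w2n n) = tau.
  have [_ _ _ _ [bp <-]] := pP n.
  exact: (bounded_pair_value norm_dot EA _ _ _ bp).
have e_cvg : e n @[n --> \oo] --> (0 : R).
  apply: (@squeeze_cvgr _ _ _ _ (fun=> 0) (fun n => n.+1%:R^-1)).
  - by apply: nearW => n; rewrite (ltW (e0 n)) ge_min lexx.
  - exact: cvg_cst.
  - exact: cvg_harmonic.
have c1 : J (w1n n) @[n --> \oo] --> J w1.
  apply: (@cvg_bound _ _ _ _ _ _ _ e) => //.
  by apply: nearW => n; have [h _ _ _ _] := pP n; exact: ltW.
have c2 : J (w2n n) @[n --> \oo] --> J w2.
  apply: (@cvg_bound _ _ _ _ _ _ _ e) => //.
  by apply: nearW => n; have [_ h _ _ _] := pP n; exact: ltW.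
exists w1n, w2n, (fun n => perturbation dot iota A E alpha tau (w1n n) (w2n n)); split.
- exact: (cvg_J norm_dot EA complHm2).
- exact: (cvg_J norm_dot EA complHm2).
- by under eq_fun do rewrite value; exact: cvg_cst.
- move=> n; have [h1 h2 d1 d2 [bp _]] := pP n; split; last by rewrite value.
    split; [by move=> /(iota_domain norm_dot saA EA complHm2)|
            by move=> /(iota_domain norm_dot saA EA complHm2)|].
    move=> w12; move: h1 h2; rewrite -/(w1n n) -/(w2n n) w12 => h1 h2.
    have := rnorm_dist _ (J w1) (J (w2n n)) (J w2).
    have : e n <= rnorm (J w1 - J w2) / 2 by rewrite ge_min lexx orbT.
    rewrite (rdistC _ (J w1) (J (w2n n))); lra.
  exact: (bounded_pair_exists norm_dot EA _ _ _ bp).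
move=> z' [Rz resA] resT.
have Jw2 : J w2 != 0.
  apply: contra_notN n2 => /eqP w20; exists 0 => //; apply: (J_inj norm_dot EA complHm2).
  by rewrite (J_iota norm_dot EA complHm2) (op0 _ (fc_linear _ _ _ bmf_qf)).
(* Being in the resolvent set of the limit operator makes the limit coefficient nonzero, and
   continuity carries this to all large [n]. *)
have g0 := krein_coef_neq0 norm_dot saA EA complHm2 _ _ resA _ _ _ _ Jw2 resT.
have gn : \forall n \near \oo, krein_coef norm_dot EA z' Rz alpha tau (J (w1n n)) (J (w2n n)) != 0.
  exact: (cvgr_neq0 _ (krein_coef_cvg norm_dot EA _ _ resA alpha tau _ _ _ _ c1 c2) g0).
split.
  apply: filterS gn => n gn0; eexists.
  exact: (perturbation_resolvent norm_dot saA EA complHm2 _ _ resA _ _ _ _ gn0).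
(* The operators [presolvent] exist for every [n], but are resolvents only once the coefficient is
   nonzero; the two sequences of norms agree eventually. *)
have := presolvent_cvg norm_dot EA _ _ resA alpha _ _ _ _ _ c1 c2 g0.
apply: cvg_trans; apply: near_eq_cvg; apply: filterS gn => n gn0.
rewrite (resolventE _ _ _ (perturbation_resolvent norm_dot saA EA complHm2 _ _ resA _ _ _ _ gn0)).
by rewrite (resolventE _ _ _ (perturbation_resolvent norm_dot saA EA complHm2 _ _ resA _ _ _ _ g0)).
Qed.
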